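(* Let $X$ be a locally compact, $\sigma$-compact, non-compact Hausdorff space, $w\in C(X)$, and $\psi:X\to X$ continuous such that $w^{-1}(\mathbb{K}\setminus\{0\})$ is dense in $X$ and such that for every $x\in X$ there is an open neighborhood $U_x$ of $x$ in $X$ such that $\psi_{|U_x}$ is injective and open. Let $C(X)$ be equipped with the compact-open topology and let $C_{w,\psi}:C(X)\to C(X)$, $f\mapsto w\cdot(f\circ\psi)$. Then the following are equivalent. (i) $C_{w,\psi}$ generates a uniformly continuous semigroup on $C(X)$. (ii) $C_{w,\psi}$ generates a strongly continuous semigroup on $C(X)$. (iii) $C_{w,\psi}$ is $m$-topologizable on $C(X)$. (iv) $C_{w,\psi}$ is topologizable on $C(X)$. (v) $\psi$ has stable orbits. Moreover, if $C_{w,\psi}$ generates a strongly continuous semigroup $T=(T_t)_{t\ge0}$ on $C(X)$, then for all $t\ge0$ and $f\in C(X)$ $$T_t(f)=\exp(tC_{w,\psi})f=\sum_{k=0}^\infty\frac{t^k}{k!}C_{w,\psi}^k(f),$$ where the series converges in the compact-open topology.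
   Context: $\mathbb{K}\in\{\mathbb{R},\mathbb{C}\}$; $C(X)$ is the space of continuous $\mathbb{K}$-valued functions on $X$, with the compact-open topology given by the seminorms $\|f\|_K=\sup_{x\in K}|f(x)|$, $K\subseteq X$ compact. $\psi^m$ is the $m$-fold iterate of $\psi$. $\psi$ has stable orbits if for every compact $K\subseteq X$ there is a compact $L\subseteq X$ with $\psi^m(K)\subseteq L$ for all $m\in\mathbb{N}$. Semigroup notions on a locally convex space $E$ are as for Banach spaces: a strongly continuous semigroup is a family $(T_t)_{t\ge0}$ of continuous linear operators on $E$ with $T_0=I$, $T_{s+t}=T_sT_t$ and $t\mapsto T_tx$ continuous for every $x\in E$; its generator is $Ax=\lim_{t\downarrow0}\frac1t(T_tx-x)$ on the domain of all $x$ for which the limit exists. It is uniformly continuous if $t\mapsto T_t$ is continuous for the topology of uniform convergence on bounded subsets of $E$. A continuous linear operator $T$ on $E$ is topologizable if for every continuous seminorm $p$ on $E$ there is a continuous seminorm $q$ on $E$ such that for every $m\in\mathbb{N}$ there is $\gamma_m>0$ with $p(T^m x)\le\gamma_m q(x)$ for all $x\in E$; $m$-topologizable if for every $p$ there are $q$ and $\gamma>0$ such that $p(T^m x)\le\gamma^m q(x)$ for all $m\in\mathbb{N}$, $x\in E$. *)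

(* Defs.v *)
From HB Require Import structures.
From mathcomp Require Import all_boot all_order all_algebra.
From mathcomp Require Import all_classical all_reals all_analysis.
From mathcomp Require Import complex.

Set Implicit Arguments.
Unset Strict Implicit.
Unset Printing Implicit Defensive.

Import Order.TTheory GRing.Theory Num.Theory.
Import numFieldNormedType.Exports.

Local Open Scope classical_set_scope.
Local Open Scope ring_scope.

(* C(X) *)
Definition cfun (X : topologicalType) (K : numFieldType) : Type :=
  continuousType X K.

Section CFunInstances.
Context (X : topologicalType) (K : numFieldType).
Implicit Types f g : cfun X K.

HB.instance Definition _ := Choice.on (cfun X K).

Lemma cfunP f g : (f : X -> K) =1 g -> f = g.
Proof. by move=> fg; apply/continuousEP. Qed.

Lemma cfun_add_subproof f g : continuous (fun x => f x + g x).
Proof. by move=> x; exact: (cvgD (@cts_fun _ _ f x) (@cts_fun _ _ g x)). Qed.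

Lemma cfun_opp_subproof f : continuous (fun x => - f x).
Proof. by move=> x; exact: (cvgN (@cts_fun _ _ f x)). Qed.

Lemma cfun_scale_subproof (a : K) f : continuous (fun x => a * f x).
Proof. by move=> x; exact: (cvgM (@cvg_cst _ _ _ _ _) (@cts_fun _ _ f x)). Qed.

Definition cfun_zero : cfun X K := cst 0.
Definition cfun_add f g : cfun X K := mkcts (@cfun_add_subproof f g).
Definition cfun_opp f : cfun X K := mkcts (@cfun_opp_subproof f).
Definition cfun_scale a f : cfun X K := mkcts (@cfun_scale_subproof a f).

Lemma cfun_addA : associative cfun_add.
Proof. by move=> f g h; apply: cfunP => x; exact: addrA. Qed.
Lemma cfun_addC : commutative cfun_add.
Proof. by move=> f g; apply: cfunP => x; exact: addrC. Qed.
Lemma cfun_add0 : left_id cfun_zero cfun_add.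
Proof. by move=> f; apply: cfunP => x; exact: add0r. Qed.
Lemma cfun_addN : left_inverse cfun_zero cfun_opp cfun_add.
Proof. by move=> f; apply: cfunP => x; exact: addNr. Qed.

HB.instance Definition _ := GRing.isZmodule.Build (cfun X K)
  cfun_addA cfun_addC cfun_add0 cfun_addN.

Lemma cfun_scaleA a b f :
  cfun_scale a (cfun_scale b f) = cfun_scale (a * b) f.
Proof. by apply: cfunP => x; exact: mulrA. Qed.
Lemma cfun_scale1 : left_id 1 cfun_scale.
Proof. by move=> f; apply: cfunP => x; exact: mul1r. Qed.
Lemma cfun_scaleDr : right_distributive cfun_scale +%R.
Proof. by move=> a f g; apply: cfunP => x; exact: mulrDr. Qed.
Lemma cfun_scaleDl f : {morph cfun_scale^~ f : a b / a + b}.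
Proof. by move=> a b; apply: cfunP => x; exact: mulrDl. Qed.

HB.instance Definition _ := GRing.Zmodule_isLmodule.Build K (cfun X K)
  cfun_scaleA cfun_scale1 cfun_scaleDr cfun_scaleDl.

HB.instance Definition _ := Topological.copy (cfun X K)
  (initial_topology (id : cfun X K -> {compact-open, X -> K})).

End CFunInstances.

Section CFunNbhs.
Context (X : topologicalType) (K : numFieldType).
Implicit Types f g : cfun X K.

Lemma cfun_nbhsP f (P : set (cfun X K)) : nbhs f P <->
  exists C : set X, compact C /\ exists e : K, 0 < e /\
    [set g : cfun X K | forall x, C x -> `|(f : X -> K) x - g x| < e] `<=` P.
Proof.
pose G := filter_from [set CE : set X * set (K * K) |
    compact CE.1 /\ entourage CE.2]
  (fun CE => [set g : X -> K | forall x, CE.1 x -> CE.2 (f x, g x)]).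
have FG : Filter G.
  apply: filter_from_filter.
    by exists (set0, setT); split; [exact: compact0|exact: filterT].
  move=> [C E] [C' E'] /= [cC eE] [cC' eE'].
  exists (C `|` C', E `&` E') => /=.
    by split; [exact: compactU|exact: filterI].
  by move=> g gP; split=> x Cx; have [] := gP x; by [left|right|].
split=> [[B [[A oA <-] Af AP]]|[C [cC [e [e0 eP]]]]].
  have /compact_open_fam_compactP : {family compact, G --> (f : X -> K)}.
    apply/fam_cvgP => C cC Q /uniform_nbhs[E [eE EQ]].
    by exists (C, E).
  move=> /(_ (@cts_fun _ _ f)) /(_ A) []; first exact: open_nbhs_nbhs.
  move=> [C E] /= [cC]; rewrite -entourage_ballE => -[e e0 eE] EA.
  exists C; split => //; exists e; split => // g gP; apply/AP/EA => x Cx.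
  by apply: eE; exact: gP.
have cts_f := @cts_fun _ _ f.
have FN := @nbhs_filter {compact-open, X -> K} f.
have famN : {family compact, nbhs (f : {compact-open, X -> K}) --> (f : X -> K)}.
  by apply/compact_open_fam_compactP.
have : nbhs (f : {compact-open, X -> K})
    [set g : X -> K | forall x, C x -> `|f x - g x| < e].
  have /fam_cvgP /(_ C cC) := famN; apply.
  apply/uniform_nbhs; exists [set xy | `|xy.1 - xy.2| < e]; split => //.
  by rewrite -entourage_ballE; exists e.
rewrite nbhsE; case=> A [oA Af] AP; rewrite nbhsE.
exists ((id : cfun X K -> {compact-open, X -> K}) @^-1` A).
  by split => //; exists A.
by move=> g Ag; apply: eP => x Cx; exact: AP Cx.
Qed.

End CFunNbhs.

Section CFunTvs.
Context (X : topologicalType) (K : numFieldType).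
Local Notation E := (cfun X K).

Lemma cfun_nbhs_dist (f : E) (C : set X) (e : K) : compact C -> 0 < e ->
  \forall g \near f, forall x, C x -> `|(f : X -> K) x - (g : E) x| < e.
Proof. by move=> cC e0; apply/cfun_nbhsP; exists C; split => //; exists e; split => // g; exact. Qed.

Lemma cfun_compact_bounded (f : E) (C : set X) : compact C ->
  exists2 M : K, 0 < M & forall x, C x -> `|(f : X -> K) x| < M.
Proof.
move=> /compact_near_coveringP.
move=> /(_ K (pinfty_nbhs K) (fun M x => `|(f : X -> K) x| < M) _) h.
have {h}/pinfty_ex_gt0 [M M0 MP] :
    \forall M \near +oo_K, C `<=` (fun x => `|(f : X -> K) x| < M).
  apply: h => x Cx.
  exists ([set y | `|(f : X -> K) x - (f : X -> K) y| < 1],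
          [set M | `|(f : X -> K) x| + 1 <= M]).
    split; first by apply: (@cvgr_dist_lt K K _ _ _ _ _ (@cts_fun _ _ f x)).
    by apply: nbhs_pinfty_ge; rewrite realD// realE normr_ge0.
  move=> [y M] /= [xy /(lt_le_trans _)]; apply.
  rewrite -[(f : X -> K) y](subrK ((f : X -> K) x)) addrC.
  by rewrite (le_lt_trans (ler_normD _ _))// ltrD2l distrC.
by exists M.
Qed.

Lemma cfun_add_continuous : continuous (fun fg : E * E => fg.1 + fg.2).
Proof.
move=> [f g] /= P /cfun_nbhsP[C [cC [e [e0 eP]]]].
have e2 : 0 < e / 2 by rewrite divr_gt0.
exists ([set h : E | forall x, C x -> `|(f : E) x - h x| < e / 2],
        [set h : E | forall x, C x -> `|(g : E) x - h x| < e / 2]).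
  by split; exact: cfun_nbhs_dist.
move=> [f' g'] /= [ff' gg']; apply: eP => x Cx /=.
rewrite [X in `|X|](_ : _ = ((f : E) x - (f' : E) x) +
  ((g : E) x - (g' : E) x)); last by rewrite addrACA -opprD.
by rewrite (le_lt_trans (ler_normD _ _))// [e]splitr ltrD ?ff' ?gg'.
Qed.

Lemma cfun_scale_continuous : continuous (fun af : K^o * E => af.1 *: af.2).
Proof.
move=> [a f] /= P /cfun_nbhsP[C [cC [e [e0 eP]]]].
have e2 : 0 < e / 2 by rewrite divr_gt0.
have [M M0 fM] := cfun_compact_bounded f cC.
have a1 : 0 < `|a| + 1 by rewrite ltr_wpDl.
exists ([set b : K | `|a - b| < e / 2 / M /\ `|a - b| < 1],
        [set h : E | forall x, C x ->
           `|(f : E) x - h x| < (`|a| + 1)^-1 * (e / 2)]).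
  split; last by apply: cfun_nbhs_dist; rewrite // mulr_gt0// invr_gt0.
  have Fa : (id : K -> K) @ a --> a by [].
  by apply: filterI; apply: (@cvgr_dist_lt K K _ _ _ _ _ Fa); rewrite ?divr_gt0.
move=> [b g] /= [[abM ab1] fg]; apply: eP => x Cx /=.
rewrite [X in `|X|](_ : _ = (a - b) * (f : E) x +
  b * ((f : E) x - (g : E) x)); last first.
  by rewrite mulrBl mulrBr addrA subrK.
rewrite (le_lt_trans (ler_normD _ _))// [e]splitr !normrM ltrD//.
  rewrite (@le_lt_trans _ _ (`|a - b| * M)) -?ltr_pdivlMr//.
  by rewrite ler_wpM2l// ltW// fM.
rewrite (@le_lt_trans _ _ ((`|a| + 1) * `|(f : E) x - (g : E) x|))//.
  rewrite ler_wpM2r// -[b](subrK a) addrC (le_trans (ler_normD _ _))//.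
  by rewrite lerD2l distrC ltW.
by rewrite -ltr_pdivlMl// fg.
Qed.

Lemma cfun_locally_convex : exists2 B : set_system E,
  (forall b, b \in B -> convex_set b) & basis B.
Proof.
pose V (f : E) (C : set X) (e : K) : set E := [set g | exists2 d, d < e &
  forall x, C x -> `|(f : X -> K) x - (g : E) x| <= d].
exists [set V1 | exists f C e, [/\ compact C, 0 < e & V1 = V f C e]].
  move=> b /set_mem [f [C [e [cC e0 ->]]]].
  apply/convex_setW => g h /set_mem[d1 d1e gP] /set_mem[d2 d2e hP] l l0 l1.
  have m0 : 0 < 1 - l%:num :> K by rewrite subr_gt0.
  apply/mem_set; exists (l%:num * d1 + (1 - l%:num) * d2).
    rewrite [ltRHS](_ : _ = l%:num * e + (1 - l%:num) * e).
      by rewrite ltrD// ltr_pM2l.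
    by rewrite -mulrDl addrC subrK mul1r.
  move=> x Cx.
  rewrite [X in `|X|](_ : _ = l%:num * ((f : X -> K) x - (g : E) x) +
    (1 - l%:num) * ((f : X -> K) x - (h : E) x)); last first.
    rewrite !mulrBr addrACA -mulrDl [l%:num + _]addrC subrK mul1r.
    by rewrite -opprD.
  rewrite (le_trans (ler_normD _ _))// !normrM (gtr0_norm l0) (gtr0_norm m0).
  by rewrite lerD// ler_pM2l// ?gP ?hP.
split.
  move=> _ [f [C [e [cC e0 ->]]]]; rewrite openE => g [d de gP].
  apply/cfun_nbhsP; exists C; split => //; exists ((e - d) / 2).
  split; first by rewrite divr_gt0// subr_gt0.
  move=> h hP; exists (d + (e - d) / 2).
    by rewrite -ltrBrDl [ltRHS]splitr ltrDl divr_gt0// subr_gt0.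
  move=> x Cx; rewrite -[X in X - _](subrK ((g : X -> K) x)) -addrA.
  by rewrite (le_trans (ler_normD _ _))// lerD ?gP// ltW// hP.
move=> f P /cfun_nbhsP[C [cC [e [e0 eP]]]].
exists (V f C e); last first.
  by move=> g [d de gP]; apply: eP => x Cx; exact: le_lt_trans (gP x Cx) de.
split; first by exists f, C, e.
by exists 0 => // x _; rewrite subrr normr0.
Qed.

(* This factory only provides the uniform structure, generated by the sets
   [set fg | U (fg.1 - fg.2)] for U a neighborhood of 0. *)
HB.instance Definition _ := PreTopologicalLmod_isTvs.Build K (cfun X K)
  cfun_add_continuous cfun_scale_continuous cfun_locally_convex.

HB.instance Definition _ := PreTopologicalNmodule_isTopologicalNmodule.Build
  (cfun X K) cfun_add_continuous.
HB.instance Definition _ := TopologicalNmodule_isTopologicalLmodule.Build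
  K (cfun X K) cfun_scale_continuous.
HB.instance Definition _ := Uniform_isTvs.Build K (cfun X K)
  cfun_locally_convex.

End CFunTvs.

(* In a numFieldType such as R[i], 0 <= t means that t is a nonnegative real,
   so below [set t : K | 0 <= t] is the half-line [0, +oo[, h --> 0^'+ is a
   limit along positive reals, and seminorms, like norms of normedModType's,
   take their (nonnegative real) values in K. *)
Section LocallyConvexSpaces.
Context (K : numFieldType) (E : tvsType K).

Definition seminorm (p : E -> K) :=
  [/\ forall x, 0 <= p x,
      forall (a : K) x, p (a *: x) = `|a| * p x &
      forall x y, p (x + y) <= p x + p y].

Definition continuous_seminorm (p : E -> K) := seminorm p /\ continuous p.

Definition tvs_bounded (B : set E) :=
  forall U : set E, nbhs 0 U -> exists2 r : K, 0 < r & B `<=` *:%R r @` U.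

Definition strongly_continuous_semigroup (T : K -> E -> E) :=
  [/\ forall t, 0 <= t -> linear (T t) /\ continuous (T t),
      T 0 = id,
      forall s t, 0 <= s -> 0 <= t -> T (s + t) = T s \o T t &
      forall x, {within [set t : K | 0 <= t], continuous (fun t => T t x)}].

Definition uniformly_continuous_semigroup (T : K -> E -> E) :=
  strongly_continuous_semigroup T /\
  {within [set t : K | 0 <= t],
    continuous (T : K -> {family tvs_bounded, E -> E})}.

Definition generator_limit (T : K -> E -> E) (x y : E) :=
  h^-1 *: (T h x - x) @[h --> (0 : K)^'+] --> y.

(* (D, A) is the generator of T *)
Definition is_generator (T : K -> E -> E) (D : set E) (A : E -> E) :=
  D = [set x | exists y, generator_limit T x y] /\
  forall x, D x -> generator_limit T x (A x).

Definition topologizable (A : E -> E) :=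
  forall p, continuous_seminorm p ->
  exists2 q, continuous_seminorm q &
  forall m : nat, exists2 c : K, 0 < c &
  forall x, p (iter m A x) <= c * q x.

Definition m_topologizable (A : E -> E) :=
  forall p, continuous_seminorm p ->
  exists2 q, continuous_seminorm q &
  exists2 c : K, 0 < c &
  forall (m : nat) x, p (iter m A x) <= c ^+ m * q x.

End LocallyConvexSpaces.

Definition sigma_compact (X : topologicalType) :=
  exists2 C : (set X)^nat, (forall n, compact (C n)) & \bigcup_n C n = setT.

Definition stable_orbits (X : topologicalType) (psi : X -> X) :=
  forall C : set X, compact C ->
  exists2 L : set X, compact L & forall m : nat, iter m psi @` C `<=` L.

Definition locally_injective_open (X : topologicalType) (psi : X -> X) :=
  forall x, exists U : set X, [/\ open_nbhs x U,
    {in U &, injective psi} &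
    forall V : set X, open V -> V `<=` U -> open (psi @` V)].

Section WeightedComposition.
Context (X : topologicalType) (K : numFieldType).
Variables (w : cfun X K) (psi : continuousType X X).

Lemma weighted_comp_subproof (f : cfun X K) :
  continuous (fun x => w x * f (psi x)).
Proof.
move=> x; apply: (cvgM (@cts_fun _ _ w x)).
by apply: continuous_comp; exact: cts_fun.
Qed.

Definition weighted_comp (f : cfun X K) : cfun X K :=
  mkcts (@weighted_comp_subproof f).

End WeightedComposition.

(* Main.v *)
(* Let A f = w (f o psi).  Everything passes through one condition: for every
   compact C there is a compact L such that f = 0 on L implies A^m f = 0 on C
   for all m.  Since psi is open, the products w(x) w(psi x) ... w(psi^(m-1) x)
   are nonzero on a dense set, so by Urysohn's lemma this condition forces
   psi^m(C) to lie in L.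
   The condition follows at once from topologizability.  For a strongly
   continuous semigroup T generated by A, a gliding hump argument shows that
   f = 0 on L implies T_t f = 0 on C for small t; differentiating on the right
   repeatedly gives T_t A^m f = 0 on C, in particular for t = 0.
   Conversely, stable orbits give |A^m f| <= M^m sup_L |f| on C, so the
   exponential series converges.  Pointwise, t |-> T_t A^j f (x) solves
   u_j' = u_(j+1) with geometric growth in j, and such solutions are determined
   by u_j(0): this gives both the semigroup law for the series and its identity
   with any semigroup generated by A. *)

Require Import Defs.
From HB Require Import structures.
From mathcomp Require Import all_boot all_order all_algebra.
From mathcomp Require Import all_classical all_reals all_analysis.
From mathcomp Require Import complex ring lra.

Import Order.TTheory GRing.Theory Num.Theory.
Import numFieldNormedType.Exports.

Local Open Scope classical_set_scope.
Local Open Scope ring_scope.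

Set Implicit Arguments.
Unset Strict Implicit.
Unset Printing Implicit Defensive.

(** * Real and complex scalars *)

(* Treats R and R[i] uniformly; [ofR_dominated] stands for completeness of K. *)
Record real_scalars (R : realType) (K : numFieldType) := RealScalars {
  ofR :> {rmorphism R -> K};
  ofR_le : {mono ofR : r s / r <= s};
  ofR_onto : forall z : K, 0 <= z -> exists r, z = ofR r;
  ofR_dominated : forall (u : nat -> K) (v : nat -> R),
    (forall n, `|u n| <= ofR (v n)) -> cvgn (series v) -> cvgn (series u) }.

Lemma dominated_series_cvg (R : realType) (u v : nat -> R) :
  (forall n, `|u n| <= v n) -> cvgn (series v) -> cvgn (series u).
Proof.
move=> uv cv; apply: normed_cvg; apply: series_le_cvg cv => // n.
  by rewrite normr_ge0.
by rewrite (le_trans (normr_ge0 _) (uv n)).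
Qed.

Lemma real_scalars_real (R : realType) : real_scalars R R.
Proof.
apply: (@RealScalars R R (@idfun R)) => //.
- by move=> z _; exists z.
- exact: dominated_series_cvg.
Qed.

Lemma real_scalars_complex (R : realType) : real_scalars R (R[i]%C : numFieldType).
Proof.
apply: (@RealScalars R R[i]%C (real_complex R)).
- by move=> r s; rewrite /= lecR.
- by move=> z z0; exists (complex.Re z); exact/esym/RRe_real/ger0_real.
- move=> u v uv cv.
  have nE n : ComplexField.Normc.normc (u n) <= v n.
    by have := uv n; rewrite /Num.norm /= lecR.
  (* Convergence is proved coordinatewise: [part] applies to any additive [p] dominated by the
     modulus, hence to both [Re] and [Im]. *)
  have part (p : R[i]%C -> R) (pD : {morph p : x y / x + y}) (p0 : p 0 = 0) :
      (forall z, `|p z| <= ComplexField.Normc.normc z) ->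
      exists l, forall e : R, 0 < e -> \forall n \near \oo, `|l - p (series u n)| < e.
    move=> pn.
    have cp : cvgn (series (p \o u)).
      by apply: dominated_series_cvg cv => n; exact: le_trans (pn _) (nE n).
    exists (limn (series (p \o u))) => e e0.
    have sE n : p (series u n) = series (p \o u) n.
      rewrite /series /=; symmetry.
      by elim/big_ind2 : _ => // x1 x2 y1 y2 -> ->.
    by near=> n; rewrite sE; near: n; apply: cvgr_dist_lt.
  have le_Re (z : R[i]%C) : `|complex.Re z| <= ComplexField.Normc.normc z.
    case: z => a b /=; rewrite -sqrtr_sqr ler_wsqrtr// lerDl sqr_ge0//.
  have leIm (z : R[i]%C) : `|complex.Im z| <= ComplexField.Normc.normc z.
    case: z => a b /=; rewrite -sqrtr_sqr ler_wsqrtr// lerDr sqr_ge0//.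
  have [] := part (@complex.Re R) _ _ le_Re; [by case=> ? ? []|by []|move=> a Ha].
  have [] := part (@complex.Im R) _ _ leIm; [by case=> ? ? []|by []|move=> b Hb].
  apply/cvg_ex; exists (a +i* b)%C.
  apply/(@cvgrPdist_lt (R[i]%C : numFieldType) (R[i]%C : numFieldType)) => e e0.
  have eE : e = (complex.Re e)%:C%C by rewrite RRe_real// gtr0_real.
  have e1 : 0 < complex.Re e by move: e0; rewrite eE ltcR.
  have e2 : 0 < complex.Re e / 2 by rewrite divr_gt0.
  near=> n.
  have ha : `|a - complex.Re (series u n)| < complex.Re e / 2 by near: n; exact: Ha.
  have hb : `|b - complex.Im (series u n)| < complex.Re e / 2 by near: n; exact: Hb.
  move: ha hb; case: (series u n) => c d /= ha hb.
  rewrite (_ : _ - _ = (a - c)%:C%C + 'i%C * (b - d)%:C%C); last first.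
    by apply/eqP; rewrite eq_complex /=; apply/andP; split; apply/eqP;
      rewrite !(mul0r,mul1r,mulr0,subr0,add0r,addr0).
  rewrite eE [in ltRHS](splitr (complex.Re e)).
  apply: le_lt_trans (ler_normD _ _) _; rewrite normrM.
  have nr (x : R) : `|(x%:C)%C : R[i]%C| = (`|x|)%:C%C.
    by rewrite normc_def /= expr0n addr0 sqrtr_sqr.
  rewrite !nr normc_def /= expr0n expr1n add0r sqrtr1 mul1r -raddfD.
  by rewrite ltcR ltrD.
Unshelve. all: by end_near. Qed.

(** * The compact-open topology *)

Section RealNorm.
Context (R : realType) (K : numFieldType) (S : real_scalars R K).
Implicit Types (x y z : K) (r e : R).

(* [`|z|] as an element of R rather than of K. *)
Definition nrm z : R := sval (cid (ofR_onto S (normr_ge0 z))).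

Lemma ofR_nrm z : S (nrm z) = `|z|.
Proof. by rewrite /nrm; case: cid. Qed.

Lemma ofR_lt : {mono S : r s / r < s}.
Proof. exact: leW_mono (ofR_le S). Qed.

Lemma ofR_gt0 {e} : 0 < e -> 0 < S e.
Proof. by rewrite -[X in X < S e](rmorph0 S) ofR_lt. Qed.

Lemma nrm_le z r : (`|z| <= S r) = (nrm z <= r).
Proof. by rewrite -ofR_nrm (ofR_le S). Qed.

Lemma nrm_lt z r : (`|z| < S r) = (nrm z < r).
Proof. by rewrite -ofR_nrm ofR_lt. Qed.

Lemma nrm_ge0 z : 0 <= nrm z.
Proof. by rewrite -(ofR_le S) rmorph0 ofR_nrm. Qed.

Lemma nrm_ofR r : nrm (S r) = `|r|.
Proof.
have nr s : 0 <= s -> nrm (S s) = s.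
  move=> s0; apply: (fmorph_inj S); rewrite ofR_nrm ger0_norm//.
  by rewrite -(rmorph0 S) (ofR_le S).
have [r0|/ltW r0] := leP 0 r; first by rewrite nr ?ger0_norm.
rewrite ler0_norm// -[RHS]nr ?oppr_ge0// rmorphN.
by apply: (fmorph_inj S); rewrite !ofR_nrm normrN.
Qed.

Lemma nrm0 : nrm 0 = 0.
Proof. by rewrite -(rmorph0 S) nrm_ofR normr0. Qed.

Lemma nrmM x y : nrm (x * y) = nrm x * nrm y.
Proof. by apply: (fmorph_inj S); rewrite rmorphM !ofR_nrm normrM. Qed.

Lemma nrmD x y : nrm (x + y) <= nrm x + nrm y.
Proof. by rewrite -(ofR_le S) rmorphD !ofR_nrm ler_normD. Qed.

Lemma nrmN x : nrm (- x) = nrm x.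
Proof. by apply: (fmorph_inj S); rewrite !ofR_nrm normrN. Qed.

Lemma nrm_dist x y : nrm (x - y) = nrm (y - x).
Proof. by rewrite -nrmN opprB. Qed.

Lemma nrm_eq0 x : (nrm x == 0) = (x == 0).
Proof. by rewrite -(inj_eq (fmorph_inj S)) ofR_nrm rmorph0 normr_eq0. Qed.

Lemma nrmV x : nrm x^-1 = (nrm x)^-1.
Proof. by apply: (fmorph_inj S); rewrite fmorphV !ofR_nrm normfV. Qed.

Lemma ofR_nrm_ge0 z : 0 <= z -> S (nrm z) = z.
Proof. by move=> z0; rewrite ofR_nrm ger0_norm. Qed.

Lemma nrm_sum (I : Type) (s : seq I) (P : pred I) (F : I -> K) :
  nrm (\sum_(i <- s | P i) F i) <= \sum_(i <- s | P i) nrm (F i).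
Proof.
elim/big_ind2 : _ => [|x1 x2 y1 y2 h1 h2|//]; first by rewrite nrm0.
by rewrite (le_trans (nrmD _ _))// lerD.
Qed.

Lemma pos_ofR (e : K) : 0 < e -> exists2 r, 0 < r & e = S r.
Proof.
move=> e0; have [r er] := ofR_onto S (ltW e0).
by exists r => //; move: e0; rewrite er -[X in X < _](rmorph0 S) ofR_lt.
Qed.

Lemma cvg_nrmP {T : Type} {F : set_system T} {FF : Filter F} (f : T -> K) z :
  f @ F --> z <-> forall e, 0 < e -> \forall x \near F, nrm (z - f x) < e.
Proof.
split=> [fz e e0|h].
  have /cvgrPdist_lt/(_ _ (ofR_gt0 e0)) := fz.
  by apply: filterS => x; rewrite nrm_lt.
apply/(@cvgrPdist_lt K K) => _ /pos_ofR[e e0 ->].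
by apply: filterS (h e e0) => x; rewrite nrm_lt.
Qed.

End RealNorm.

Section SupNorm.
Context (R : realType) (K : numFieldType) (S : real_scalars R K).
Context (X : topologicalType).
Local Notation nrm := (nrm S).
Local Notation E := (cfun X K).
Implicit Types (f g : E) (C : set X) (e : R).

Lemma cfun_nbhs_nrmP f (P : set E) : nbhs f P <->
  exists2 C : set X, compact C & exists2 e : R, 0 < e &
    [set g : E | forall x, C x -> nrm (f x - g x) < e] `<=` P.
Proof.
split=> [/cfun_nbhsP[C [cC [_ [/(pos_ofR S)[e e0 ->] eP]]]]|[C cC [e e0 eP]]].
  exists C => //; exists e => // g gP; apply: eP => x Cx.
  by rewrite nrm_lt gP.
apply/cfun_nbhsP; exists C; split => //; exists (S e).
split; first exact: ofR_gt0.
by move=> g gP; apply: eP => x Cx; rewrite -nrm_lt gP.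
Qed.

Lemma cfun_cvgP {T : Type} {F : set_system T} {FF : Filter F} (u : T -> E) f :
  u @ F --> f <-> forall C e, compact C -> 0 < e ->
    \forall t \near F, forall x, C x -> nrm (f x - u t x) < e.
Proof.
split=> [uf C e cC e0|h P /cfun_nbhs_nrmP[C cC [e e0 eP]]].
  apply: (uf [set g : E | forall x, C x -> nrm (f x - g x) < e]).
  by apply/cfun_nbhs_nrmP; exists C => //; exists e.
by apply: filterS (h C e cC e0) => t; exact: eP.
Qed.

Lemma cfun_bounded f C : compact C ->
  exists2 M : R, 0 < M & forall x, C x -> nrm (f x) <= M.
Proof.
move=> cC; have [_ /(pos_ofR S)[M M0 ->] fM] := cfun_compact_bounded f cC.
by exists M => // x Cx; rewrite ltW// -nrm_lt fM.
Qed.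

(** On the empty set this is 0, the default value of [sup]; hence the condition [0 <= M] in
    [supnrm_le]. *)
Definition supnrm C f : R := sup [set nrm (f x) | x in C].

Lemma supnrm_ub C f x : compact C -> C x -> nrm (f x) <= supnrm C f.
Proof.
move=> cC Cx; have [M _ fM] := cfun_bounded f cC.
apply: sup_upper_bound; last by exists x.
by split; [exists (nrm (f x)), x|exists M => _ [y Cy <-]; exact: fM].
Qed.

Lemma supnrm_le C f M : 0 <= M -> (forall x, C x -> nrm (f x) <= M) ->
  supnrm C f <= M.
Proof.
move=> M0 fM; have [->|/set0P[x Cx]] := eqVneq C set0.
  by rewrite /supnrm image_set0 sup0.
apply: ge_sup; first by exists (nrm (f x)), x.
by move=> _ [y Cy <-]; exact: fM.
Qed.

Lemma supnrm_ge0 C f : compact C -> 0 <= supnrm C f.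
Proof.
move=> cC; have [->|/set0P[x Cx]] := eqVneq C set0.
  by rewrite /supnrm image_set0 sup0.
exact: le_trans (nrm_ge0 S _) (supnrm_ub f cC Cx).
Qed.

Lemma supnrmD C f g : compact C ->
  supnrm C (f + g) <= supnrm C f + supnrm C g.
Proof.
move=> cC; apply: supnrm_le; first by rewrite addr_ge0 ?supnrm_ge0.
by move=> x Cx; rewrite (le_trans (nrmD S _ _))// lerD ?supnrm_ub.
Qed.

Lemma supnrmZ C (a : K) f : compact C -> supnrm C (a *: f) = nrm a * supnrm C f.
Proof.
move=> cC; have le (b : K) g : supnrm C (b *: g) <= nrm b * supnrm C g.
  apply: supnrm_le; first by rewrite mulr_ge0 ?supnrm_ge0 ?nrm_ge0.
  by move=> x Cx; rewrite nrmM ler_wpM2l ?nrm_ge0 ?supnrm_ub.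
apply/eqP; rewrite eq_le le /=.
have [->|a0] := eqVneq a 0; first by rewrite nrm0 mul0r supnrm_ge0.
have n0 : 0 < nrm a by rewrite lt_neqAle eq_sym nrm_eq0 a0 nrm_ge0.
rewrite -ler_pdivlMl// -nrmV (le_trans _ (le _ _))//.
by rewrite scalerA mulVf// scale1r.
Qed.

Lemma supnrm_continuous_seminorm C : compact C ->
  continuous_seminorm (S \o supnrm C : E -> K).
Proof.
move=> cC; split.
  split=> [f|a f|f g] /=.
  - by rewrite -(rmorph0 S) (ofR_le S) supnrm_ge0.
  - by rewrite supnrmZ// rmorphM ofR_nrm.
  - by rewrite -rmorphD (ofR_le S) supnrmD.
move=> f; apply/(@cvg_nrmP _ _ S E (nbhs f)) => e e0.
have e2 : 0 < e / 2 by rewrite divr_gt0.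
have : nbhs f [set g : E | forall x, C x -> nrm (f x - g x) < e / 2].
  by apply/cfun_nbhs_nrmP; exists C => //; exists (e / 2).
apply: filterS => g gP /=; rewrite -rmorphB nrm_ofR.
have d (h k : E) : (forall x, C x -> nrm (h x - k x) < e / 2) ->
    supnrm C h <= supnrm C k + e / 2.
  move=> hk; rewrite -[h](subrK k) addrC (le_trans (supnrmD _ _ cC))// lerD2l.
  by apply: supnrm_le => [|x Cx]; rewrite ltW// hk.
apply: (@le_lt_trans _ _ (e / 2)); last by rewrite ltr_pdivrMr// ltr_pMr// ltr1n.
rewrite ler_norml lerBlDr lerBrDr addrC lerBlDr d//=; last first.
  by move=> x Cx; rewrite nrm_dist gP.
by rewrite addrC d.
Qed.

(** Continuity at 0 gives [L] and [e] such that [p < 1] on functions smaller than [e] on [L];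
    homogeneity then gives [c = 1 / e]. *)
Lemma continuous_seminorm_supnrm (p : E -> K) : continuous_seminorm p ->
  exists2 L, compact L & exists2 c : R, 0 < c & forall f, p f <= S (c * supnrm L f).
Proof.
move=> [[p0 pZ pD] cp].
have p00 : p 0 = 0 by rewrite -(scale0r (0 : E)) pZ normr0 mul0r.
have /(@cvg_nrmP _ _ S E (nbhs (0 : E)))/(_ 1 ltr01) := cp (0 : E).
move=> /cfun_nbhs_nrmP[L cL [e e0 eP]]; exists L => //; exists e^-1.
  by rewrite invr_gt0.
move=> f; have [r pr] := ofR_onto S (p0 f); rewrite pr (ofR_le S).
apply/ler_addgt0Pr => d d0; set s := supnrm L f.
have s0 : 0 <= s by exact: supnrm_ge0.
have sd : 0 < s + e * d by rewrite ltr_wpDl// mulr_gt0.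
(* The slack [e * d] keeps the denominator positive when [f] vanishes on [L]; it costs [d] in the
   final bound. *)
have : nrm (p (S (e / (s + e * d)) *: f)) < 1.
  rewrite -[X in nrm X]opprK nrmN -[- p _]add0r -p00; apply: eP => x Lx.
  rewrite sub0r nrmN nrmM nrm_ofR ger0_norm ?divr_ge0 ?ltW//.
  rewrite -mulrA gtr_pMr// mulrC ltr_pdivrMr// mul1r.
  by rewrite (le_lt_trans (supnrm_ub _ cL Lx))// ltrDl mulr_gt0.
rewrite pZ pr -(ofR_nrm S) nrmM !nrm_ofR -/s normr_id.
have -> : `|e / (s + e * d)| = e / (s + e * d).
  by rewrite ger0_norm// divr_ge0// ltW.
rewrite mulrAC ltr_pdivrMr// mul1r mulrC -ltr_pdivlMr// => h.
rewrite (le_trans (ler_norm _))// ltW// (lt_le_trans h)//.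
by rewrite mulrDl mulrAC divff ?gt_eqF// mul1r mulrC.
Qed.

End SupNorm.

(** * Stable orbits and locally determined iterates *)

Section Topology.
Context (X : topologicalType).
Implicit Types (C L V : set X).

(** Near-covering compactness is applied to the filter of compact sets directed by inclusion: if [V]
    is a compact neighbourhood of a point, every compact set containing [V] is a neighbourhood of
    all points of the interior of [V]. *)
Lemma compact_neighborhood C : locally_compact [set: X] -> compact C ->
  exists2 L, compact L & forall x, C x -> nbhs x L.
Proof.
move=> lcX /compact_near_coveringP cC.
pose F : set_system (set X) := filter_from [set D | compact D]
  (fun D => [set D' | compact D' /\ D `<=` D']).
have FF : Filter F.
  apply: filter_from_filter; first by exists set0; exact: compact0.
  move=> D D' cD cD'; exists (D `|` D'); first exact: compactU.
  by move=> D'' [cD'' DD]; split; split => // x Dx; apply: DD; [left|right].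
have [] := cC _ F (fun D x => nbhs x D) FF.
  move=> x Cx; have [V] := lcX x I; rewrite withinET => xV [cV _].
  exists (V°, [set D' | compact D' /\ V `<=` D']).
    by split; [exact: nbhs_interior|exists V].
  by move=> [y D] /= [Vy [_ VD]]; exact: filterS VD Vy.
by move=> D cD CD; exists D => //; exact: (CD D (conj cD (fun=> id))).
Qed.

Lemma compact_exhaustion : locally_compact [set: X] -> sigma_compact X ->
  exists L : nat -> set X, [/\ forall n, compact (L n),
    forall m n, (m <= n)%N -> L m `<=` L n,
    forall x : X, exists n, nbhs x (L n) &
    forall C, compact C -> exists n, C `<=` L n].
Proof.
move=> lcX [C cC CX].
have /choice[D DP] n : exists L, compact L /\ forall x, C n x -> nbhs x L.
  by have [L cL CL] := compact_neighborhood lcX (cC n); exists L.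
pose L n := \big[setU/set0]_(i < n) D i.
have LS m n : (m <= n)%N -> L m `<=` L n.
  elim: n => [|n IH]; first by rewrite leqn0 => /eqP ->.
  rewrite leq_eqVlt ltnS => /predU1P[->//|/IH mn]; apply: subset_trans mn _.
  by rewrite /L big_ord_recr; left.
have Lx (x : X) : exists n, nbhs x (L n).
  have : (\bigcup_n C n) x by rewrite CX.
  move=> [n _ Cx]; exists n.+1; apply: filterS (proj2 (DP n) x Cx).
  by rewrite /L big_ord_recr; right.
exists L; split => // [n|A /compact_near_coveringP cA].
  elim: n => [|n IH]; first by rewrite /L big_ord0; exact: compact0.
  by rewrite /L big_ord_recr; apply: compactU IH (proj1 (DP n)).
have [] := cA _ \oo (fun n => L n) _; last by move=> n _ An; exists n; apply: An => /=.
move=> x Ax; have [n nx] := Lx x.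
exists ((L n)°, [set m | (n <= m)%N]).
  by split; [exact: nbhs_interior|exists n].
by move=> [y m] /= [Ly nm]; apply: LS nm _ _; exact: interior_subset.
Qed.

Lemma locally_injective_open_map (psi : X -> X) : locally_injective_open psi ->
  forall V, open V -> open (psi @` V).
Proof.
move=> psiP V oV; rewrite openE => _ [x Vx <-].
have [U [[oU Ux] _ UP]] := psiP x.
have oVU : open (psi @` (V `&` U)) by apply: UP; [exact: openI|exact: subIsetr].
apply: filterS (open_nbhs_nbhs (conj oVU _)); last by exists x.
by apply: image_subset; exact: subIsetl.
Qed.

(* An open map pulls dense sets back to dense sets. *)
Lemma dense_along_orbit (psi : continuousType X X) (D : set X) (m : nat) V :
    (forall V, open V -> open (psi @` V)) -> open D -> dense D ->
  open V -> V !=set0 ->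
  exists2 x, V x & forall i, (i < m)%N -> D (iter i psi x).
Proof.
move=> psio oD dD; elim: m V => [|m IH] V oV V0.
  by have [x Vx] := V0; exists x.
have VD0 : V `&` D !=set0 by exact: dD.
have oVD : open (psi @` (V `&` D)) by apply/psio/openI.
have [] := IH _ oVD; first by have [x VDx] := VD0; exists (psi x), x.
move=> _ [x [Vx Dx] <-] xD; exists x => // -[//|i] im.
by rewrite iterSr; exact: xD.
Qed.

End Topology.

Section StableOrbits.
Context (R : realType) (K : numFieldType) (S : real_scalars R K).
Context (X : topologicalType).
Local Notation nrm := (nrm S).
Local Notation E := (cfun X K).
Context (w : E) (psi : continuousType X X).
Local Notation A := (weighted_comp w psi).

(** Stated for an arbitrary operator, so that it can be derived both from topologizability and from
    generating a semigroup. *)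
Definition locally_determined_iterates (B : E -> E) :=
  forall C, compact C -> exists2 L, compact L &
  forall f : E, (forall x, L x -> f x = 0) ->
  forall m x, C x -> iter m B f x = 0.

Lemma iter_weighted_comp m (f : E) x : iter m A f x =
  (\prod_(i < m) w (iter i psi x)) * f (iter m psi x).
Proof.
elim: m x => [|m IH] x; first by rewrite big_ord0 mul1r.
rewrite iterS -[LHS]/(w x * iter m A f (psi x)) IH big_ord_recl -mulrA iterSr.
congr (_ * (_ * _)).
by apply: eq_bigr => i _; rewrite -iterSr.
Qed.

(** Complete regularity of locally compact Hausdorff spaces separates [y] from the closed set [L] by
    a real function [g]; then [1 - g] is transported to [K]. *)
Lemma urysohn_point (L : set X) (y : X) : locally_compact [set: X] ->
  hausdorff_space X -> compact L -> ~ L y ->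
  exists2 f : E, f y != 0 & forall x, L x -> f x = 0.
Proof.
move=> lcX hX cL Ly.
have /(@uniform_separatorP _ R)[g [cg _ g0 g1]] : uniform_separator [set y] L.
  apply: (@locally_compact_completely_regular X R lcX hX) Ly.
  exact: compact_closed.
have cf : continuous (fun x => S (1 - g x)).
  move=> x; apply/(cvg_nrmP S) => e e0.
  have /(@cvgrPdist_lt R R)/(_ e e0) := cg x.
  apply: filterS => z; rewrite -rmorphB nrm_ofR opprB [1 - _ + _]addrC.
  by rewrite addrA subrK distrC.
exists (mkcts cf : E) => [|x Lx].
  rewrite -[X in X != 0]/(S (1 - g y)) (_ : g y = 0); last by apply: g0; exists y.
  by rewrite subr0 rmorph1 oner_neq0.
by rewrite -[LHS]/(S (1 - g x)) (_ : g x = 1) ?subrr ?rmorph0//; apply: g1; exists x.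
Qed.

(** The set [L] is taken for a compact neighbourhood [C'] of [C]. If the orbit of a point of [C]
    left [L] at time [m], the point could be moved inside [C'] to a [z] where no weight factor
    vanishes; a function vanishing on [L] but not at [iter m psi z] then contradicts the choice of
    [L]. *)
Lemma stable_orbits_of_local : locally_compact [set: X] -> hausdorff_space X ->
  dense (w @^-1` [set a : K | a != 0]) -> locally_injective_open psi ->
  locally_determined_iterates A -> stable_orbits psi.
Proof.
move=> lcX hX wd psiP loc C cC.
have [C' cC' CC'] := compact_neighborhood lcX cC.
have [L cL LP] := loc _ cC'; exists L => // m _ [x Cx <-].
apply: contrapT => Lx.
have cpsi i : continuous (iter i psi).
  elim: i => [|i IH] z; first exact: cvg_id.
  by apply: continuous_comp; [exact: IH|exact: cts_fun].
pose V : set X := C'° `&` iter m psi @^-1` ~` L.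
have oV : open V.
  apply: openI; first exact: open_interior.
  apply: open_comp => [? _|]; first exact: cpsi.
  by rewrite openC; exact: compact_closed.
have oD : open (w @^-1` [set a : K | a != 0]).
  apply: open_comp => [? _|]; first exact: cts_fun.
  rewrite openE => a a0; have := @cvg_id _ (nbhs a).
  move/(cvg_nrmP S)/(_ (nrm a)); rewrite lt_neqAle eq_sym nrm_eq0 nrm_ge0 andbT.
  move=> /(_ a0); apply: filterS => z; apply: contraTneq => ->.
  by rewrite subr0 ltxx.
have [] := dense_along_orbit m (locally_injective_open_map psiP) oD wd oV.
  by exists x; split => //; exact: CC'.
move=> z [Cz Lz] wz.
have [f fz fL] := urysohn_point lcX hX cL Lz.
have /eqP := LP f fL m z (interior_subset Cz).
rewrite iter_weighted_comp mulf_eq0 (negbTE fz) orbF prodf_seq_eq0.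
by move=> /hasP[i _ /=]; exact/negP/wz.
Qed.

(** The constants may depend on [m], but they multiply [q f], which is 0 as soon as [f] vanishes on
    a compact set controlling [q]. *)
Lemma topologizable_local (B : E -> E) : topologizable B ->
  locally_determined_iterates B.
Proof.
move=> tB C cC.
have [q cq qP] := tB _ (supnrm_continuous_seminorm S cC).
have [L cL [c c0 qL]] := continuous_seminorm_supnrm S cq.
exists L => // f fL m x Cx; have [d d0 /(_ f) /= df] := qP m.
have f0 : supnrm S L f = 0.
  apply/eqP; rewrite eq_le supnrm_ge0// andbT.
  by apply: supnrm_le => // y Ly; rewrite fL// nrm0.
have qf : q f = 0.
  apply/eqP; rewrite eq_le; case: cq => -[-> _ _] _; rewrite andbT.
  by rewrite (le_trans (qL f))// f0 mulr0 rmorph0.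
apply/eqP; rewrite -(nrm_eq0 S) eq_le nrm_ge0 andbT.
rewrite (le_trans (supnrm_ub S (iter m B f) cC Cx))//.
by rewrite -(ofR_le S) rmorph0 (le_trans df)// qf mulr0.
Qed.

End StableOrbits.

(** * Semigroups and their generators *)

Section SemigroupGenerator.
Context (R : realType) (K : numFieldType) (S : real_scalars R K).
Context (X : topologicalType).
Local Notation nrm := (nrm S).
Local Notation E := (cfun X K).
Context (T : K -> E -> E) (scT : strongly_continuous_semigroup T).
Context (B : E -> E) (genT : is_generator T setT B).
Local Notation U t := (T (S t)).
Implicit Types (C L : set X) (f g : E) (t s h e d : R).

Let ofR_ge0 t : 0 <= t -> 0 <= S t.
Proof. by rewrite -[X in X <= S t](rmorph0 S) (ofR_le S). Qed.

Lemma semigroup_linear t : 0 <= t -> linear (U t).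
Proof. by case: scT => /(_ (S t)) lT _ _ _ /ofR_ge0/lT[]. Qed.

Lemma semigroup_continuous t : 0 <= t -> continuous (U t).
Proof. by case: scT => /(_ (S t)) lT _ _ _ /ofR_ge0/lT[]. Qed.

Lemma semigroupD t f g : 0 <= t -> U t (f + g) = U t f + U t g.
Proof. by move=> /semigroup_linear/(_ 1 f g); rewrite !scale1r. Qed.

Lemma semigroup_zero t : 0 <= t -> U t 0 = 0.
Proof.
by move=> t0; apply: (addrI (U t 0)); rewrite addr0 -semigroupD// addr0.
Qed.

Lemma semigroupZ t a f : 0 <= t -> U t (a *: f) = a *: U t f.
Proof.
move=> t0; rewrite -[in LHS](addr0 (a *: f)) (semigroup_linear t0).
by rewrite semigroup_zero// addr0.
Qed.

Lemma semigroupB t f g : 0 <= t -> U t (f - g) = U t f - U t g.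
Proof.
by move=> t0; rewrite semigroupD// -scaleN1r semigroupZ// scaleN1r.
Qed.

Lemma semigroup0 f : U 0 f = f.
Proof. by case: scT => _ T0 _ _; rewrite rmorph0 T0. Qed.

Lemma semigroup_add s t f : 0 <= s -> 0 <= t -> U (s + t) f = U s (U t f).
Proof.
case: scT => _ _ TD _ /ofR_ge0 s0 /ofR_ge0 t0.
by rewrite rmorphD TD.
Qed.

Lemma semigroup_cvg f t : 0 <= t -> forall C e, compact C -> 0 < e ->
  exists2 d, 0 < d & forall s, 0 <= s -> `|t - s| < d ->
    forall x, C x -> nrm (U t f x - U s f x) < e.
Proof.
move=> t0 C e cC e0; case: scT => _ _ _ /(_ f)/subspace_continuousP.
move=> /(_ (S t) (ofR_ge0 t0))/(cfun_cvgP S)/(_ C e cC e0).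
rewrite near_withinE => /nbhs_ballP[_ /(pos_ofR S)[d d0 ->] dP].
exists d => // s s0 ts x Cx; apply: dP => //; last exact: ofR_ge0.
by rewrite -ball_normE /= -rmorphB (nrm_lt S) nrm_ofR.
Qed.

Lemma cvg_at_right0 (u : K -> E) f : u h @[h --> (0 : K)^'+] --> f ->
  forall C e, compact C -> 0 < e ->
  exists2 d, 0 < d & forall h, 0 < h -> h < d ->
    forall x, C x -> nrm (f x - u (S h) x) < e.
Proof.
move=> uf C e cC e0.
have : \forall h \near (0 : K)^'+, forall x, C x -> nrm (f x - u h x) < e.
  by move: uf => /(cfun_cvgP S); apply.
rewrite near_withinE => /nbhs_ballP[_ /(pos_ofR S)[d d0 ->] dP].
exists d => // h h0 hd x Cx; apply: dP => //; last exact: ofR_gt0.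
by rewrite -ball_normE /= sub0r normrN (nrm_lt S) nrm_ofR gtr0_norm.
Qed.

(** The continuous operator [U t] commutes with [T h], so it carries the difference quotient at time
    0 to the one at time [t]: orbits are right differentiable everywhere. *)
Lemma semigroup_generator_cvg t f : 0 <= t ->
  h^-1 *: (T h (U t f) - U t f) @[h --> (0 : K)^'+] --> U t (B f).
Proof.
move=> t0; have St0 := ofR_ge0 t0; case: genT => _ /(_ f I) Bf.
have : U t (h^-1 *: (T h f - f)) @[h --> (0 : K)^'+] --> U t (B f).
  by apply: continuous_cvg Bf; exact: semigroup_continuous.
apply: cvg_trans; apply: near_eq_cvg; rewrite near_withinE.
apply: nearW => h h0; have [r hr] := ofR_onto S (ltW h0).
have r0 : 0 <= r by rewrite -(ofR_le S) rmorph0 -hr ltW.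
rewrite /= semigroupZ// semigroupB//; congr (_ *: (_ - _)).
by rewrite hr -!semigroup_add// addrC.
Qed.

(** Both sides are limits of one difference quotient, since [U t f] lies in the domain too.
    Uniqueness of limits is used pointwise, in [K]. *)
Lemma semigroup_generator_commute t f : 0 <= t -> U t (B f) = B (U t f).
Proof.
move=> t0; apply: cfunP => x.
have ev (g : E) : h^-1 *: (T h (U t f) - U t f) @[h --> (0 : K)^'+] --> g ->
    (h^-1 *: (T h (U t f) - U t f) : E) x @[h --> (0 : K)^'+] --> g x.
  move=> /(cfun_cvgP S) cg; apply/(cvg_nrmP S) => e e0.
  have := cg [set x] e (@compact_set1 _ x) e0.
  by apply: filterS => h; apply.
have := ev _ (semigroup_generator_cvg t0).
move=> /(cvg_unique (@norm_hausdorff K K)); apply.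
by apply: ev; case: genT => _; apply.
Qed.

Lemma semigroup_right_derivative f t x e : 0 <= t -> 0 < e ->
  exists2 d, 0 < d & forall h, 0 < h -> h < d ->
    nrm (U (t + h) f x - U t f x - S h * U t (B f) x) <= e * h.
Proof.
move=> t0 e0.
have [d d0 dP] := cvg_at_right0 (semigroup_generator_cvg (f := f) t0)
  (@compact_set1 _ x) e0.
exists d => // h h0 hd; have := dP h h0 hd x erefl.
rewrite [in U (t + h) f]addrC semigroup_add ?(ltW h0)// => /ltW.
set v := U h _ x; set u := U t f x; set b := U t _ x.
rewrite -[X in nrm X <= e]/(b - (S h)^-1 * (v - u)) => bP.
have Sh0 : S h != 0 by rewrite gt_eqF// ofR_gt0.
have -> : v - u - S h * b = - (S h * (b - (S h)^-1 * (v - u))).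
  by rewrite mulrBr mulrA divff// mul1r opprB.
by rewrite nrmN nrmM nrm_ofR gtr0_norm// mulrC ler_wpM2r// ltW.
Qed.

(** Continuity at 0 bounds [U t g] by 1 on [C] for every [g] vanishing on [L]. Such functions are
    stable under scaling, so a nonzero value could be normalised to 1, against the strict bound. *)
Lemma semigroup_local t C : 0 <= t -> compact C -> exists2 L, compact L &
  forall g, (forall x, L x -> g x = 0) -> forall x, C x -> U t g x = 0.
Proof.
move=> t0 cC; have := semigroup_continuous t0 (x := 0).
rewrite /continuous_at semigroup_zero// => /(cfun_cvgP S)/(_ C 1 cC ltr01).
move=> /(cfun_nbhs_nrmP S)[L cL [d d0 dP]]; exists L => // g gL x Cx.
apply: contrapT => /eqP gx0.
pose a := (U t g x)^-1.
have /(_ x Cx) : forall y, C y -> nrm ((0 : E) y - U t (a *: g) y) < 1.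
  apply: dP => y Ly.
  by rewrite -[X in nrm X]/(0 - _ * g y) gL// mulr0 subr0 nrm0.
rewrite semigroupZ// -[X in nrm X]/(0 - a * U t g x).
by rewrite mulVf// sub0r nrmN -(rmorph1 S) nrm_ofR normr1 ltxx.
Qed.

End SemigroupGenerator.

(** * The gliding hump *)

Section LocalDetermination.
Context (R : realType) (K : numFieldType) (S : real_scalars R K).
Context (X : topologicalType).
Local Notation nrm := (nrm S).
Local Notation E := (cfun X K).
Context (T : K -> E -> E) (scT : strongly_continuous_semigroup T).
Context (B : E -> E) (genT : is_generator T setT B).
Local Notation U t := (T (S t)).
Implicit Types (C L : set X) (f g : E) (t s h e d : R).

(* Gliding hump: otherwise there are times t_n -> 0 and functions f_n vanishing
   on larger and larger compact sets with U t_n f_n != 0 on C.  The sum of the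
   c_n f_n is locally finite, hence converges for all scalars c_n, and these can
   be chosen so that its orbit is unbounded on C as t_n -> 0. *)
Lemma semigroup_locally_equilocal C : locally_compact [set: X] ->
  sigma_compact X -> compact C -> exists2 L, compact L & exists2 d, 0 < d &
  forall g, (forall x, L x -> g x = 0) ->
  forall t, 0 <= t -> t < d -> forall x, C x -> U t g x = 0.
Proof.
move=> lcX scX cC; have [L [cL LS Lx LC]] := compact_exhaustion lcX scX.
apply: contrapT => hump.
have {}hump m d : 0 < d -> exists g t x, [/\ forall y, L m y -> g y = 0,
    0 <= t, t < d, C x & U t g x != 0].
  move=> d0; apply: contrapT => nhump; apply: hump; exists (L m) => //.
  exists d => // g gL t t0 td x Cx; apply: contrapT => /eqP gx.
  by apply: nhump; exists g, t, x.
(* A state consists of a step number, the index of an exhausting compact set and a partial sum. The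
   last clause protects the value reached at [(t, x)]: later corrections vanish on the new compact
   set and cannot change it. *)
pose step (a b : nat * nat * E) := [/\ b.1.1 = a.1.1.+1, (a.1.2 < b.1.2)%N,
  forall y, L a.1.2 y -> b.2 y = a.2 y &
  exists t x, [/\ 0 <= t, t < a.1.1.+1%:R^-1, C x,
    U t b.2 x = a.1.1%:R &
    forall g, (forall y, L b.1.2 y -> g y = 0) -> U t g x = 0]].
have stepP a : {b | step a b}.
  apply: cid; case: a => [[n m] f].
  have [|g [t [x [gL t0 tn Cx gx]]]] := hump m n.+1%:R^-1.
    by rewrite invr_gt0 ltr0n.
  have [L' cL' L'P] := semigroup_local S scT t0 cC.
  have [m' L'm] := LC _ cL'.
  (* The coefficient moves the value at [x] after time [t] from [U t f x] to [n]. *)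
  exists (n.+1, maxn m.+1 m', f + ((n%:R - U t f x) / U t g x) *: g).
  split => //=; first by rewrite leq_max leqnn.
    by move=> y Ly; rewrite -[LHS]/(f y + _ * g y) gL// mulr0 addr0.
  exists t, x; split => //.
    rewrite semigroupD// semigroupZ//.
    rewrite -[LHS]/(U t f x + (n%:R - U t f x) / U t g x * U t g x).
    by rewrite mulfVK// addrC subrK.
  move=> h hL; apply: L'P => // y /L'm Ly; apply: hL.
  by apply: LS Ly; exact: leq_maxr.
have [s [s0 sP]] := dependent_choice stepP (0%N, 0%N, 0 : E).
have sn n : (s n).1.1 = n.
  by elim: n => [|n IH]; [rewrite s0|case: (sP n) => ->; rewrite IH].
have sm n : (n <= (s n).1.2)%N.
  by elim: n => // n IH; case: (sP n) => _ + _ _; exact: leq_ltn_trans.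
have mono j k : (j <= k)%N -> ((s j).1.2 <= (s k).1.2)%N.
  elim: k => [|k IH]; first by rewrite leqn0 => /eqP ->.
  rewrite leq_eqVlt ltnS => /predU1P[->//|/IH jk].
  by apply: leq_trans jk _; case: (sP k) => _ /ltnW.
have stab j k y : (j <= k)%N -> L (s j).1.2 y -> (s k).2 y = (s j).2 y.
  move=> + Ly; elim: k => [|k IH]; first by rewrite leqn0 => /eqP ->.
  rewrite leq_eqVlt ltnS => /predU1P[->//|jk]; rewrite -(IH jk).
  by case: (sP k) => _ _ + _; apply; exact: LS (mono _ _ jk) _ Ly.
have stable j k y : L (s j).1.2 y -> L (s k).1.2 y -> (s k).2 y = (s j).2 y.
  by have [jk|/ltnW kj] := leqP j k => Lj Lk; [|symmetry]; exact: stab.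
have /choice[k kP] (x : X) : exists k, nbhs x (L (s k).1.2).
  have [n nx] := Lx x; exists n; apply: filterS nx.
  by apply: LS; exact: sm.
(* [G] is the locally finite sum: the partial sums are eventually constant on each exhausting set,
   and [k x] selects such a set that is a neighbourhood of [x]. So [G] is locally one of the partial
   sums, hence continuous. *)
pose G x := (s (k x)).2 x.
have GE j y : L (s j).1.2 y -> G y = (s j).2 y.
  by move=> Ly; apply: stable => //; exact: nbhs_singleton (kP y).
have cG : continuous G.
  move=> x; have := @cts_fun _ _ (s (k x)).2 x.
  rewrite /continuous_at -/(G x); apply: cvg_trans; apply: near_eq_cvg.
  by apply: filterS (kP x) => y /GE.
have [M M0 GM] := cfun_bounded S (mkcts cG : E) cC.
have [d d0 dP] := semigroup_cvg S scT (mkcts cG : E) (lexx 0) cC ltr01.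
(* Before time [d] the orbit of [G] is within 1 of [G], so smaller than [M + 1] on [C]; but the hump
   of step [n] gives it the value [n] at a time below [1 / (n + 1)]. *)
have [n nd nM] : exists2 n : nat, n.+1%:R^-1 < d & M + 1 <= n%:R.
  have [i ? iP] : exists2 i : nat, True & d^-1 < i%:R.
    by exists (Num.truncn d^-1).+1 => //; exact: truncnS_gt.
  have [j ? jP] : exists2 j : nat, True & M + 1 < j%:R.
    by exists (Num.truncn (M + 1)).+1 => //; exact: truncnS_gt.
  exists (maxn i j).
    rewrite invf_plt ?posrE// (lt_le_trans iP)// ler_nat.
    by rewrite (leq_trans (leq_maxl i j)).
  by rewrite (le_trans (ltW jP))// ler_nat leq_maxr.
have [_ _ _ [t [x [t0 tn Cx Ut Uloc]]]] := sP n; rewrite sn in tn Ut.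
have UG : U t (mkcts cG : E) x = n%:R.
  rewrite -Ut; apply/eqP; rewrite -subr_eq0; apply/eqP.
  rewrite -[LHS]/((U t (mkcts cG : E) - U t (s n.+1).2) x) -semigroupB//.
  by apply: Uloc => y Ly; rewrite -[LHS]/(G y - (s n.+1).2 y) (GE _ _ Ly) subrr.
have := dP t t0; rewrite sub0r normrN ger0_norm// => /(_ (lt_trans tn nd) x Cx).
rewrite UG (semigroup0 S scT); apply/negP; rewrite -leNgt.
have : n%:R <= nrm ((mkcts cG : E) x) + nrm ((mkcts cG : E) x - n%:R).
  have -> : n%:R = nrm n%:R :> R by rewrite -(rmorph_nat S) nrm_ofR normr_nat.
  rewrite -[in leLHS](subrK ((mkcts cG : E) x) n%:R).
  by rewrite (le_trans (nrmD S _ _))// addrC nrm_dist.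
move=> /(le_trans nM); have := GM x Cx => h1 h2.
rewrite -(lerD2l M) (le_trans h2)// lerD2r.
exact: h1.
Qed.

(* If [U t f] vanishes on C for all small t, so does its right derivative
   [U t (B f)]. *)
Lemma semigroup_local_iterates : locally_compact [set: X] -> sigma_compact X ->
  locally_determined_iterates B.
Proof.
move=> lcX scX C cC.
have [L cL [d d0 LP]] := semigroup_locally_equilocal lcX scX cC.
exists L => // f fL m x Cx.
suff /(_ 0 (lexx _) d0) : forall t, 0 <= t -> t < d -> U t (iter m B f) x = 0.
  by rewrite (semigroup0 S scT).
elim: m => [|m IH] t t0 td; first exact: LP.
set g := iter m B f in IH; rewrite iterS -/g.
apply/eqP; rewrite -(nrm_eq0 S) eq_le nrm_ge0 andbT.
apply/ler_addgt0Pr => e e0; rewrite add0r.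
have [d' d'0 dP] := semigroup_right_derivative S scT genT g x t0 e0.
pose h := Num.min ((d - t) / 2) (d' / 2).
have dt : 0 < d - t by rewrite subr_gt0.
have h0 : 0 < h by rewrite lt_min !divr_gt0.
have hd : t + h < d.
  rewrite -ltrBrDl (@le_lt_trans _ _ ((d - t) / 2)) ?ge_min ?lexx//.
  by rewrite ltr_pdivrMr// ltr_pMr// ltr1n.
have hd' : h < d'.
  rewrite (@le_lt_trans _ _ (d' / 2)) ?ge_min ?lexx ?orbT//.
  by rewrite ltr_pdivrMr// ltr_pMr// ltr1n.
have := dP h h0 hd'; rewrite !IH ?addr_ge0 ?(ltW h0)//.
rewrite subrr sub0r nrmN nrmM nrm_ofR gtr0_norm// mulrC.
by rewrite ler_pM2r.
Qed.

End LocalDetermination.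

(** * Estimates from stable orbits *)

Section StableEstimates.
Context (R : realType) (K : numFieldType) (S : real_scalars R K).
Context (X : topologicalType).
Local Notation nrm := (nrm S).
Local Notation E := (cfun X K).
Context (w : E) (psi : continuousType X X).
Local Notation A := (weighted_comp w psi).

(** Along orbits starting in [C] all [m] weight factors, and the argument of [f], are evaluated in
    one compact [L], on which [w] is bounded by [M]. *)
Lemma stable_orbits_bound (C : set X) : stable_orbits psi -> compact C ->
  exists2 L, compact L & exists2 M : R, 0 < M &
  forall (f : E) m x, C x -> nrm (iter m A f x) <= supnrm S L f * M ^+ m.
Proof.
move=> st cC; have [L cL LP] := st C cC; exists L => //.
have [M M0 wM] := cfun_bounded S w cL; exists M => // f m x Cx.
have Lx i : L (iter i psi x) by apply: (LP i); exists x.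
rewrite iter_weighted_comp nrmM mulrC ler_pM ?nrm_ge0 ?supnrm_ub//.
elim: m => [|m IH]; first by rewrite big_ord0 expr0 -(rmorph1 S) nrm_ofR normr1.
by rewrite big_ord_recr /= nrmM exprSr ler_pM ?nrm_ge0 ?wM.
Qed.

Lemma continuous_seminormZ (V : tvsType K) (p : V -> K) (c : K) : 0 <= c ->
  continuous_seminorm p -> continuous_seminorm (fun x => c * p x).
Proof.
move=> c0 [[p0 pZ pD] cp]; split; first split.
- by move=> x; rewrite mulr_ge0.
- by move=> a x; rewrite pZ mulrCA.
- by move=> x y; rewrite -mulrDr ler_wpM2l.
- by move=> x; apply: cvgM; [exact: cvg_cst|exact: cp].
Qed.

Lemma m_topologizable_of_stable : stable_orbits psi -> m_topologizable A.
Proof.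
move=> st p cp; have [C cC [c c0 pC]] := continuous_seminorm_supnrm S cp.
have [L cL [M M0 AM]] := stable_orbits_bound st cC.
(* The constant [c] must go into the seminorm: for [m = 0] the factor [S M ^+ m] is 1. *)
exists (fun f => S c * (S \o supnrm S L) f).
  apply: continuous_seminormZ; last exact: supnrm_continuous_seminorm.
  by rewrite ltW// ofR_gt0.
exists (S M) => [|m f]; first exact: ofR_gt0.
rewrite (le_trans (pC _))// -rmorphXn /= -!rmorphM (ofR_le S) mulrCA.
rewrite ler_wpM2l ?(ltW c0)// supnrm_le//; last by move=> x; rewrite mulrC; exact: AM.
by rewrite mulr_ge0 ?supnrm_ge0// exprn_ge0// ltW.
Qed.

End StableEstimates.

(** * Exponential sums *)

Section ExponentialSums.
Context (R : realType) (K : numFieldType) (S : real_scalars R K).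
Local Notation nrm := (nrm S).
Implicit Types (a : nat -> K) (s t h e N M : R) (n k : nat).

(** The remainder of a dominated series is at most that of the majorant; [n = 0] bounds the whole
    sum. Partial sums beyond [n] are compared first, with slack [e] for the limit. *)
Lemma dominated_series_le (u : nat -> K) (l : K) (v : nat -> R) (b : R) n :
  series u @ \oo --> l -> series v @ \oo --> b ->
  (forall k, nrm (u k) <= v k) -> nrm (l - series u n) <= b - series v n.
Proof.
move=> ul vb uv; apply/ler_addgt0Pr => e e0.
have ndv : nondecreasing_seq (series v).
  by apply: nondecreasing_series => k *; exact: le_trans (nrm_ge0 S _) (uv k).
have vle m : series v m <= b.
  rewrite -(cvg_lim _ vb)//; apply: nondecreasing_cvgn_le => //.
  by apply/cvg_ex; exists b.
have /(cvg_nrmP S)/(_ e e0)[m _ mP] := ul.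
have := mP (maxn m n) (leq_maxl m n); set j := maxn m n => lj.
rewrite -[l](subrK (series u j)) -addrA addrC (le_trans (nrmD S _ _))//.
rewrite lerD ?(ltW lj)//.
have nj : (n <= j)%N by exact: leq_maxr.
have -> : series u j - series u n = \sum_(n <= k < j) u k by rewrite sub_series_geq.
rewrite (le_trans (nrm_sum S _ _ _))// (le_trans (ler_sum _ (fun k _ => uv k)))//.
by rewrite -sub_series_geq// lerD2r.
Qed.

(** Prepending 0 aligns the term of index [k] of a derivative with the term of index [k + 1] it
    comes from, for the termwise comparison in [exp_sum_tangent]. *)
Lemma cvg_series_shift (F : numFieldType) (u : nat -> F) (l : F) :
  series u @ \oo --> l ->
  series (fun k => if k is k'.+1 then u k' else 0) @ \oo --> l.
Proof.
move=> ul; rewrite -(cvg_shiftS (series _)).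
suff -> : (fun n => series (fun k => if k is k'.+1 then u k' else 0) n.+1) =
  series u by [].
by apply/funext => n; rewrite /series /= big_nat_recl// add0r.
Qed.

Lemma cvg_series_expR t : series (exp_coeff t) @ \oo --> expR t.
Proof. exact: is_cvg_series_exp_coeff. Qed.

(** Convexity of powers on the half-line, by induction: multiplying the inequality for [n] by
    [t + h] leaves a surplus of [n.+1%:R * h ^+ 2 * t ^+ n]. *)
Lemma exprD_ge_tangent t h n : 0 <= t -> 0 <= h ->
  t ^+ n.+1 + n.+1%:R * h * t ^+ n <= (t + h) ^+ n.+1.
Proof.
move=> t0 h0; elim: n => [|n IH]; first by rewrite !expr1 expr0 mulr1 mul1r.
rewrite exprS [leRHS]exprS (le_trans _ (ler_wpM2l (addr_ge0 t0 h0) IH))//.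
rewrite -subr_ge0 (_ : _ - _ = n.+1%:R * h ^+ 2 * t ^+ n).
  by rewrite !mulr_ge0 ?exprn_ge0.
by rewrite -[n.+2%:R]natr1 !exprS; ring.
Qed.

(** The same inequality divided by [(n + 1)!]: each exponential coefficient has the preceding one as
    derivative. *)
Lemma exp_coeff_tangent t h n : 0 <= t -> 0 <= h ->
  exp_coeff t n.+1 + h * exp_coeff t n <= exp_coeff (t + h) n.+1.
Proof.
move=> t0 h0; rewrite /exp_coeff /= ler_pdivlMr ?ltr0n ?fact_gt0//.
apply: le_trans (exprD_ge_tangent n t0 h0).
rewrite mulrDl divfK ?pnatr_eq0 -?lt0n ?fact_gt0// lerD2l.
rewrite factS natrM -[leLHS]mulrA [_ * (_ * n`!%:R)]mulrCA.
rewrite divfK ?pnatr_eq0 -?lt0n ?fact_gt0//.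
by rewrite mulrCA mulrA.
Qed.

(** With [a k] the value of [iter k A f] at [x], this is the exponential of [t A] applied to [f], at
    [x]. Working with scalar sequences reduces the analysis to comparison with the real
    exponential. *)
Definition exp_sum a t : K := limn (series (fun k => S (exp_coeff t k) * a k)).

Lemma exp_coeffM t M k : exp_coeff t k * M ^+ k = exp_coeff (t * M) k.
Proof. by rewrite /exp_coeff /= exprMn mulrAC. Qed.

Lemma cvg_series_MexpR N t :
  series (fun k => N * exp_coeff t k) @ \oo --> N * expR t.
Proof.
rewrite (_ : series _ = (fun n => N * series (exp_coeff t) n)).
  by apply: cvgM; [exact: cvg_cst|exact: cvg_series_expR].
by apply/funext => n; rewrite /series /= mulr_sumr.
Qed.

Section Dominated.
Context (a : nat -> K) (N M : R).
Hypothesis aP : forall k, nrm (a k) <= N * M ^+ k.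

Lemma cvg_exp_sum t : 0 <= t ->
  series (fun k => S (exp_coeff t k) * a k) @ \oo --> exp_sum a t.
Proof.
move=> t0; apply: (ofR_dominated (r := S) (v := fun k => N * exp_coeff (t * M) k)).
  move=> k; rewrite (nrm_le S) nrmM nrm_ofR ger0_norm ?exp_coeff_ge0//.
  by rewrite -exp_coeffM mulrCA ler_wpM2l ?exp_coeff_ge0.
by apply/cvg_ex; exists (N * expR (t * M)); exact: cvg_series_MexpR.
Qed.

Lemma exp_sum_tail t n : 0 <= t ->
  nrm (exp_sum a t - series (fun k => S (exp_coeff t k) * a k) n) <=
  N * (expR (t * M) - series (exp_coeff (t * M)) n).
Proof.
move=> t0; rewrite (_ : N * _ = N * expR (t * M) -
  series (fun k => N * exp_coeff (t * M) k) n); last first.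
  by rewrite mulrBr [N * series _ n]mulr_sumr.
have := dominated_series_le n (cvg_exp_sum t0) (@cvg_series_MexpR N (t * M)).
apply => k.
rewrite nrmM nrm_ofR ger0_norm ?exp_coeff_ge0//.
by rewrite -exp_coeffM mulrCA ler_wpM2l ?exp_coeff_ge0.
Qed.

Lemma exp_sum_bound t : 0 <= t -> nrm (exp_sum a t) <= N * expR (t * M).
Proof.
by move=> /(@exp_sum_tail _ 0); rewrite /series /= !big_geq// !subr0.
Qed.

(** The coefficients increase with time, so the differences are nonnegative and the termwise
    domination of [a] sums up to a difference of real exponentials. *)
Lemma exp_sum_dist s t : 0 <= s -> s <= t ->
  nrm (exp_sum a t - exp_sum a s) <= N * (expR (t * M) - expR (s * M)).
Proof.
move=> s0 st; have t0 := le_trans s0 st.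
pose u k := S (exp_coeff t k) * a k - S (exp_coeff s k) * a k.
pose v k := N * exp_coeff (t * M) k - N * exp_coeff (s * M) k.
have := @dominated_series_le u (exp_sum a t - exp_sum a s) v
  (N * expR (t * M) - N * expR (s * M)) 0.
rewrite /series /= !big_geq// !subr0 mulrBr; apply.
- rewrite (_ : (fun n => _) = (fun n => series (fun k => S (exp_coeff t k) * a k) n -
    series (fun k => S (exp_coeff s k) * a k) n)).
    by apply: cvgB; exact: cvg_exp_sum.
  by apply/funext => n; rewrite /series /= -sumrB.
- rewrite (_ : (fun n => _) = (fun n => series (fun k => N * exp_coeff (t * M) k) n -
    series (fun k => N * exp_coeff (s * M) k) n)).
    by apply: cvgB; exact: cvg_series_MexpR.
  by apply/funext => n; rewrite /series /= -sumrB.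
move=> k; rewrite /u /v -mulrBl -rmorphB nrmM nrm_ofR -mulrBr -!exp_coeffM.
rewrite -[exp_coeff _ _ * _ - _]mulrBl.
have d0 : 0 <= exp_coeff t k - exp_coeff s k.
  by rewrite subr_ge0 /exp_coeff /= ler_wpM2r ?invr_ge0// lerXn2r// nnegrE.
by rewrite ger0_norm// mulrCA ler_wpM2l.
Qed.

End Dominated.

(** The derivative of an exponential sum is the sum of the shifted sequence. By [exp_coeff_tangent]
    the coefficients of the first-order remainder are nonnegative, so it is bounded by the same
    remainder for [N * expR (t * M)]. *)
Lemma exp_sum_tangent a N M t h :
  (forall k, nrm (a k) <= N * M ^+ k) -> 0 <= t -> 0 <= h ->
  nrm (exp_sum a (t + h) - exp_sum a t - S h * exp_sum (a \o succn) t) <=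
  N * (expR ((t + h) * M) - expR (t * M) - h * M * expR (t * M)).
Proof.
move=> aP t0 h0.
have aP1 k : nrm ((a \o succn) k) <= (N * M) * M ^+ k by rewrite -mulrA -exprS aP.
have th0 : 0 <= t + h by exact: addr_ge0.
pose sh (F : numFieldType) (u : nat -> F) k := if k is k'.+1 then u k' else 0.
pose ta k := S (exp_coeff t k) * a k.+1.
pose tN k := N * exp_coeff (t * M) k.
pose u k := S (exp_coeff (t + h) k) * a k - S (exp_coeff t k) * a k -
  S h * sh K ta k.
pose v k := N * exp_coeff ((t + h) * M) k - N * exp_coeff (t * M) k -
  h * M * sh R tN k.
have cu : series u @ \oo -->
    exp_sum a (t + h) - exp_sum a t - S h * exp_sum (a \o succn) t.
  rewrite (_ : series u = (fun n =>
    series (fun k => S (exp_coeff (t + h) k) * a k) n -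
    series (fun k => S (exp_coeff t k) * a k) n - S h * series (sh K ta) n)).
    apply: cvgB; first by apply: cvgB; exact: cvg_exp_sum aP _ _.
    apply: cvgM; first exact: cvg_cst.
    by apply: cvg_series_shift; exact: cvg_exp_sum aP1 _ _.
  by apply/funext => n; rewrite /series /= mulr_sumr -!sumrB.
have cv : series v @ \oo --> N * expR ((t + h) * M) - N * expR (t * M) -
    h * M * (N * expR (t * M)).
  rewrite (_ : series v = (fun n =>
    series (fun k => N * exp_coeff ((t + h) * M) k) n -
    series (fun k => N * exp_coeff (t * M) k) n - h * M * series (sh R tN) n)).
    apply: cvgB; first by apply: cvgB; exact: cvg_series_MexpR.
    apply: cvgM; first exact: cvg_cst.
    by apply: cvg_series_shift; exact: cvg_series_MexpR.
  by apply/funext => n; rewrite /series /= mulr_sumr -!sumrB.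
have := dominated_series_le 0 cu cv.
rewrite /series /= !big_geq// !subr0 => dom.
rewrite !mulrBr [N * (h * M * _)]mulrCA; apply: dom => -[|k].
  rewrite /u /v /= /exp_coeff /= !expr0 !mulr0 !subr0 -mulrBl subrr mul0r nrm0.
  by rewrite -mulrBr subrr mulr0.
rewrite /u /v /= /ta /tN -mulrBl mulrA -mulrBl -rmorphM -!rmorphB nrmM nrm_ofR.
have d0 : 0 <= exp_coeff (t + h) k.+1 - exp_coeff t k.+1 - h * exp_coeff t k.
  by rewrite -addrA -opprD subr_ge0 exp_coeff_tangent.
rewrite ger0_norm// (le_trans (ler_wpM2l d0 (aP k.+1)))//.
rewrite -!exp_coeffM exprS; set p := M ^+ k.
by rewrite le_eqVlt; apply/orP; left; apply/eqP; ring.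
Qed.

End ExponentialSums.

(** The supremum of the initial segments on which [P] holds is attained by the left condition and
    equals [b] by the right one. *)
Lemma real_induction (R : realType) (P : R -> Prop) (b : R) :
  P 0 ->
  (forall t, 0 <= t -> t < b -> (forall s, 0 <= s -> s <= t -> P s) ->
    exists2 d, 0 < d & forall h, 0 < h -> h < d -> P (t + h)) ->
  (forall t, 0 < t -> t <= b -> (forall s, 0 <= s -> s < t -> P s) -> P t) ->
  forall t, 0 <= t -> t <= b -> P t.
Proof.
move=> P0 Pr Pl t t0 tb.
pose D := [set r | [/\ 0 <= r, r <= b & forall s, 0 <= s -> s <= r -> P s]].
have D0 : D 0.
  split=> //; first exact: le_trans tb.
  by move=> s s0 s1; rewrite (_ : s = 0)//; apply/eqP; rewrite eq_le s0 s1.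
have supD : has_sup D by split; [exists 0|exists b => r []].
have s0 : 0 <= sup D by exact: sup_upper_bound.
have sb : sup D <= b by apply: ge_sup; [exists 0|move=> r []].
have lt_sup s : 0 <= s -> s < sup D -> P s.
  move=> s_ge0 ss; have [r [_ _ rP] sr] := sup_gt (ex_intro _ 0 D0) ss.
  by apply: rP => //; exact: ltW.
have Psup : forall s, 0 <= s -> s <= sup D -> P s.
  move=> s s_ge0; rewrite le_eqVlt => /predU1P[->|]; last exact: lt_sup.
  move: s0; rewrite le_eqVlt => /predU1P[<-//|s_gt0].
  exact: Pl.
have sE : sup D = b.
  apply/eqP; rewrite eq_le sb leNgt; apply/negP => sltb.
  have [d d0 dP] := Pr _ s0 sltb Psup.
  pose h := Num.min (d / 2) (b - sup D).
  have h0 : 0 < h by rewrite lt_min divr_gt0// subr_gt0.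
  suff : D (sup D + h) by move=> /(sup_upper_bound supD); rewrite leNgt ltrDl h0.
  split; first by rewrite addr_ge0// ltW.
    by rewrite -lerBrDl ge_min lexx orbT.
  move=> s s_ge0 sh; have [ss|ss] := leP s (sup D); first exact: Psup.
  rewrite -(subrK (sup D) s) addrC; apply: dP; first by rewrite subr_gt0.
  rewrite ltrBlDl (le_lt_trans sh)// ltrD2l gt_min ltr_pdivrMr// ltr_pMr//.
  by rewrite ltr1n.
by apply: Psup => //; rewrite sE.
Qed.

(** * Comparison by right derivatives *)

Section RightDerivatives.
Context (R : realType) (K : numFieldType) (S : real_scalars R K).
Local Notation nrm := (nrm S).
Local Notation exp_sum := (exp_sum S).
Implicit Types (t s h e d N M C b : R) (j k n : nat).

(** A mean value inequality in which [phi] only has to lie above its tangents. The bound with an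
    extra linear slack spreads to the right by the derivative estimate, and to a left limit by
    continuity of [g] and monotonicity of [phi]. *)
Lemma right_mean_value (g : R -> K) (phi dphi : R -> R) b :
  (forall t e, 0 <= t -> 0 < e -> exists2 d, 0 < d &
    forall s, 0 <= s -> `|t - s| < d -> nrm (g t - g s) < e) ->
  (forall t e, 0 <= t -> t < b -> 0 < e -> exists2 d, 0 < d &
    forall h, 0 < h -> h < d -> nrm (g (t + h) - g t) <= (dphi t + e) * h) ->
  (forall t h, 0 <= t -> 0 <= h -> phi t + dphi t * h <= phi (t + h)) ->
  (forall t, 0 <= t -> 0 <= dphi t) ->
  nrm (g 0) <= phi 0 ->
  forall t, 0 <= t -> t <= b -> nrm (g t) <= phi t.
Proof.
move=> cg dg tangent dphi0 g0 t t0 tb; apply/ler_addgt0Pr => e e0.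
have mono s r : 0 <= s -> s <= r -> phi s <= phi r.
  move=> s0 sr; rewrite -(subrK s r) addrC.
  have rs : 0 <= r - s by rewrite subr_ge0.
  by rewrite (le_trans _ (tangent _ _ s0 rs))// lerDl mulr_ge0// dphi0.
have bt : 0 <= b by exact: le_trans tb.
(* The slack [e' * t] is at most [e] on the interval; adding 1 covers [b = 0]. *)
pose e' := e / (b + 1).
have b1 : 0 < b + 1 by rewrite ltr_wpDl.
have e'0 : 0 < e' by rewrite divr_gt0.
suff /(_ t t0 tb) h : forall t, 0 <= t -> t <= b -> nrm (g t) <= phi t + e' * t.
  rewrite (le_trans h)// lerD2l /e' mulrAC ler_pdivrMr// ler_wpM2l ?(ltW e0)//.
  by rewrite (le_trans tb)// lerDl.
move=> {t t0 tb}; apply: real_induction; first by rewrite mulr0 addr0.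
  move=> t t0 tb /(_ t t0 (lexx t)) gt.
  have [d d0 dP] := dg t e' t0 tb e'0; exists d => // h h0 hd.
  rewrite -(subrK (g t) (g (t + h))) (le_trans (nrmD S _ _))//.
  rewrite (le_trans (lerD (dP h h0 hd) gt))//.
  rewrite addrC mulrDl addrACA -mulrDr lerD2r.
  by rewrite tangent// ltW.
move=> t t0 tb gs; apply/ler_addgt0Pr => e2 e20.
have [d d0 dP] := cg t e2 (ltW t0) e20.
pose h := Num.min (d / 2) t.
have h0 : 0 < h by rewrite lt_min divr_gt0.
have ht : h <= t by rewrite ge_min lexx orbT.
have s0 : 0 <= t - h by rewrite subr_ge0.
have st : t - h < t by rewrite gtrBl.
have hd : `|t - (t - h)| < d.
  rewrite opprB addrC subrK gtr0_norm// gt_min ltr_pdivrMr// ltr_pMr//.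
  by rewrite ltr1n.
rewrite -(subrK (g (t - h)) (g t)) addrC (le_trans (nrmD S _ _))//.
rewrite lerD ?(ltW (dP _ s0 hd))// (le_trans (gs _ s0 st))// lerD//.
  exact: mono (ltW st).
by rewrite ler_wpM2l// ltW.
Qed.

Lemma expR_tangent_small t M N e : 0 <= M -> 0 <= N -> 0 < e ->
  exists2 d, 0 < d & forall h, 0 < h -> h < d ->
  N * (expR ((t + h) * M) - expR (t * M) - h * M * expR (t * M)) <= e * h.
Proof.
move=> M0 N0 e0; pose c := N * expR (t * M) * M + 1.
have c0 : 0 < c by rewrite ltr_wpDl// !mulr_ge0// expR_ge0.
have ec : 0 < e / c by rewrite divr_gt0.
have /(@cvgrPdist_lt R R)/(_ (e / c) ec) := @continuous_expR R 0.
move=> /nbhs_ballP[d /= d0 dP]; have M1 : 0 < M + 1 by rewrite ltr_wpDl.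
exists (d / (M + 1)); first by rewrite divr_gt0.
move=> h h0 hd; have hM0 : 0 <= h * M by rewrite mulr_ge0// ltW.
have : `|expR 0 - expR (h * M)| < e / c.
  apply: dP; rewrite -ball_normE /= sub0r normrN ger0_norm//.
  rewrite (@le_lt_trans _ _ (h * (M + 1))) -?ltr_pdivlMr//.
  by rewrite ler_pM2l// lerDl.
rewrite expR0 distrC ltr_norml => /andP[_ hE].
(* With [x = h * M], this is [1 - x <= expR (- x)] multiplied by [expR x]. *)
have key : expR (h * M) - 1 - h * M <= h * M * (expR (h * M) - 1).
  have := expR_ge1Dx (- (h * M)); rewrite expRN => le1.
  have E0 := expR_gt0 (h * M).
  rewrite -(ler_pM2r E0) mulVf ?gt_eqF// in le1.
  by rewrite -subr_ge0; lra.
have E0 := expR_ge0 (t * M).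
rewrite mulrDl expRD.
rewrite (_ : N * _ = N * expR (t * M) * (expR (h * M) - 1 - h * M)); last by ring.
have NE : 0 <= N * expR (t * M) by rewrite mulr_ge0.
rewrite (le_trans (ler_wpM2l NE key))//.
rewrite (_ : N * _ * _ = h * (N * expR (t * M) * M * (expR (h * M) - 1))); last by ring.
rewrite [leRHS]mulrC ler_pM2l//.
have E1 : 0 <= expR (h * M) - 1 by rewrite subr_ge0 -expR0 ler_expR.
have h1 : N * expR (t * M) * M <= c by rewrite lerDl.
rewrite (le_trans (ler_wpM2r E1 h1))// mulrC -ler_pdivlMr//.
exact: ltW.
Qed.

(** Integrate [n] times from zero initial values: the bound on [v j.+1] gives one on [v j] with one
    more power of [t * M] and the matching factorial. Letting [n] grow forces [v 0] to vanish. *)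
Lemma right_derivative_chain_zero (v : nat -> R -> K) C M b :
  0 <= M -> 0 <= C ->
  (forall j t e, 0 <= t -> 0 < e -> exists2 d, 0 < d &
    forall s, 0 <= s -> `|t - s| < d -> nrm (v j t - v j s) < e) ->
  (forall j t e, 0 <= t -> 0 < e -> exists2 d, 0 < d & forall h, 0 < h ->
    h < d -> nrm (v j (t + h) - v j t - S h * v j.+1 t) <= e * h) ->
  (forall j, v j 0 = 0) ->
  (forall j t, 0 <= t -> t <= b -> nrm (v j t) <= C * M ^+ j) ->
  forall t, 0 <= t -> t <= b -> v 0 t = 0.
Proof.
move=> M0 C0 cv dv v0 vC.
have CM j : 0 <= C * M ^+ j by rewrite mulr_ge0// exprn_ge0.
have vn n j t : 0 <= t -> t <= b ->
    nrm (v j t) <= C * M ^+ j * exp_coeff (t * M) n.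
  elim: n j t => [|n IH] j t t0 tb.
    by rewrite /exp_coeff /= expr0 divr1 mulr1 vC.
  pose phi t := C * M ^+ j * exp_coeff (t * M) n.+1.
  pose dphi t := C * M ^+ j.+1 * exp_coeff (t * M) n.
  apply: (@right_mean_value (v j) phi dphi b) => //.
  - exact: cv.
  - move=> {t0 tb}t e t0 tb e0; have [d d0 dP] := dv j t e t0 e0.
    exists d => // h h0 hd; rewrite -[v j _ - _](subrK (S h * v j.+1 t)).
    rewrite (le_trans (nrmD S _ _))// addrC mulrDl lerD ?dP//.
    rewrite nrmM nrm_ofR gtr0_norm// mulrC ler_wpM2r ?(ltW h0)//.
    by apply: IH => //; exact: ltW.
  - move=> {t0 tb}t h t0 h0; rewrite /phi /dphi mulrDl.
    have := exp_coeff_tangent n (mulr_ge0 t0 M0) (mulr_ge0 h0 M0).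
    move=> /(ler_wpM2l (CM j)); apply: le_trans.
    by rewrite mulrDr lerD2l le_eqVlt exprS; apply/orP; left; apply/eqP; ring.
  - move=> {t0 tb}t t0; rewrite /dphi mulr_ge0// exp_coeff_ge0//.
    exact: mulr_ge0.
  rewrite v0 nrm0 /phi mulr_ge0// exp_coeff_ge0//.
  by rewrite mul0r.
move=> t t0 tb; apply/eqP; rewrite -(nrm_eq0 S) eq_le nrm_ge0 andbT.
have : (fun n => C * M ^+ 0 * exp_coeff (t * M) n) @ \oo --> C * M ^+ 0 * 0.
  by apply: cvgM; [exact: cvg_cst|exact: cvg_exp_coeff].
rewrite mulr0 => cu; rewrite -(cvg_lim (@Rhausdorff R) cu).
by apply: limr_ge; [exact: cvgP cu|apply: nearW => n; exact: vn].
Qed.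

End RightDerivatives.

(** * Uniqueness and addition law for exponential sums *)

Section ExpSumUniqueness.
Context (R : realType) (K : numFieldType) (S : real_scalars R K).
Local Notation nrm := (nrm S).
Local Notation exp_sum := (exp_sum S).
Implicit Types (a : nat -> K) (t s h e d N M b : R) (j k n : nat).

Lemma exp_dominated_ge0 a N M : (forall k, nrm (a k) <= N * M ^+ k) -> 0 <= N.
Proof. by move=> /(_ 0%N); rewrite mulr1; exact/le_trans/nrm_ge0. Qed.

Lemma exp_dominated_shift a N M j : (forall k, nrm (a k) <= N * M ^+ k) ->
  forall k, nrm (a (k + j)%N) <= N * M ^+ j * M ^+ k.
Proof. by move=> aP k; rewrite -mulrA -exprD addnC aP. Qed.

Lemma expR_dist_small t M N e : 0 < e -> exists2 d, 0 < d &
  forall s, `|t - s| < d -> N * `|expR (t * M) - expR (s * M)| < e.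
Proof.
move=> e0; have n1 : 0 < `|N| + 1 by rewrite ltr_wpDl.
have eN : 0 < e / (`|N| + 1) by rewrite divr_gt0.
have : (fun s => expR (s * M)) s @[s --> t] --> expR (t * M).
  apply: continuous_cvg; first exact: continuous_expR.
  by apply: cvgM; [exact: cvg_id|exact: cvg_cst].
move=> /(@cvgrPdist_lt R R)/(_ _ eN)/nbhs_ballP[d /= d0 dP].
exists d => // s ts; have {ts} := dP s ts.
rewrite ltr_pdivlMr// mulrC; apply: le_lt_trans.
by rewrite ler_wpM2r// (le_trans (ler_norm _))// lerDl.
Qed.

Lemma exp_sum_dist_norm a N M s t : 0 <= M ->
  (forall k, nrm (a k) <= N * M ^+ k) -> 0 <= s -> 0 <= t ->
  nrm (exp_sum a t - exp_sum a s) <= N * `|expR (t * M) - expR (s * M)|.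
Proof.
move=> M0 aP s0 t0.
have [st|/ltW ts] := leP s t.
  rewrite ger0_norm; first exact: exp_sum_dist aP _ _ _ _.
  by rewrite subr_ge0 ler_expR ler_wpM2r.
rewrite nrm_dist distrC ger0_norm; first exact: exp_sum_dist aP _ _ _ _.
by rewrite subr_ge0 ler_expR ler_wpM2r.
Qed.

Lemma exp_sum_continuous a N M t e : 0 <= M ->
  (forall k, nrm (a k) <= N * M ^+ k) -> 0 <= t -> 0 < e ->
  exists2 d, 0 < d & forall s, 0 <= s -> `|t - s| < d ->
    nrm (exp_sum a t - exp_sum a s) < e.
Proof.
move=> M0 aP t0 e0; have [d d0 dP] := expR_dist_small t M N e0.
exists d => // s s0 ts; apply: le_lt_trans (dP s ts).
exact: exp_sum_dist_norm.
Qed.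

Lemma exp_sum_right_derivative a N M t e : 0 <= M ->
  (forall k, nrm (a k) <= N * M ^+ k) -> 0 <= t -> 0 < e ->
  exists2 d, 0 < d & forall h, 0 < h -> h < d ->
    nrm (exp_sum a (t + h) - exp_sum a t - S h * exp_sum (a \o succn) t)
      <= e * h.
Proof.
move=> M0 aP t0 e0.
have [d d0 dP] := expR_tangent_small t M0 (exp_dominated_ge0 aP) e0.
exists d => // h h0 hd; apply: le_trans (dP h h0 hd).
by apply: exp_sum_tangent => //; exact: ltW.
Qed.

Lemma exp_sum0 a N M : (forall k, nrm (a k) <= N * M ^+ k) ->
  exp_sum a 0 = a 0%N.
Proof.
move=> aP; have := exp_sum_tail aP 1 (lexx 0).
rewrite mul0r expR0 series_exp_coeff0 subrr mulr0 /series /= big_nat1.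
rewrite /exp_coeff /= expr0 divr1 rmorph1 mul1r => le0.
by apply/eqP; rewrite -subr_eq0 -(nrm_eq0 S) eq_le le0 nrm_ge0.
Qed.

Lemma exp_sumD a1 a2 (c : K) N1 N2 M1 M2 t :
  (forall k, nrm (a1 k) <= N1 * M1 ^+ k) ->
  (forall k, nrm (a2 k) <= N2 * M2 ^+ k) -> 0 <= t ->
  exp_sum (fun k => c * a1 k + a2 k) t = c * exp_sum a1 t + exp_sum a2 t.
Proof.
move=> a1P a2P t0; apply: (@cvg_lim K); first exact: norm_hausdorff.
rewrite (_ : series _ = (fun n => c * series (fun k => S (exp_coeff t k) * a1 k) n
  + series (fun k => S (exp_coeff t k) * a2 k) n)).
  apply: cvgD; last exact: cvg_exp_sum a2P _ _.
  by apply: cvgM; [exact: cvg_cst|exact: cvg_exp_sum a1P _ _].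
apply/funext => n; rewrite /series /= mulr_sumr -big_split /=.
by apply: eq_bigr => k _; rewrite mulrDr mulrCA.
Qed.

Lemma exp_sumZ a (c : K) N M t :
  (forall k, nrm (a k) <= N * M ^+ k) -> 0 <= t ->
  exp_sum (fun k => c * a k) t = c * exp_sum a t.
Proof.
move=> aP t0; apply: (@cvg_lim K); first exact: norm_hausdorff.
rewrite (_ : series _ = (fun n => c * series (fun k => S (exp_coeff t k) * a k) n)).
  by apply: cvgM; [exact: cvg_cst|exact: cvg_exp_sum aP _ _].
apply/funext => n; rewrite /series /= mulr_sumr.
by apply: eq_bigr => k _; rewrite mulrCA.
Qed.

(* Takes the place of a Cauchy product in [exp_sum_add] and of Taylor's formula
   for semigroups in [semigroup_exp_sum]. *)
Lemma exp_sum_unique (u : nat -> R -> K) N M b : 0 <= M ->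
  (forall j t e, 0 <= t -> 0 < e -> exists2 d, 0 < d &
    forall s, 0 <= s -> `|t - s| < d -> nrm (u j t - u j s) < e) ->
  (forall j t e, 0 <= t -> 0 < e -> exists2 d, 0 < d & forall h, 0 < h ->
    h < d -> nrm (u j (t + h) - u j t - S h * u j.+1 t) <= e * h) ->
  (forall j t, 0 <= t -> t <= b -> nrm (u j t) <= N * M ^+ j) ->
  forall t, 0 <= t -> t <= b -> u 0%N t = exp_sum (fun k => u k 0) t.
Proof.
move=> M0 cu du uN t t0 tb; have b0 : 0 <= b by exact: le_trans tb.
have uP k : nrm (u k 0) <= N * M ^+ k by exact: uN.
have N0 := exp_dominated_ge0 uP.
pose a j k := u (k + j)%N 0.
have aP j k : nrm (a j k) <= N * M ^+ j * M ^+ k.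
  exact: (exp_dominated_shift j uP).
have aS j : a j \o succn = a j.+1.
  by apply/funext => k; rewrite /a /= addSnnS.
have a0 : (fun k => u k 0) = a 0%N by apply/funext => k; rewrite /a addn0.
apply/eqP; rewrite -subr_eq0 a0; apply/eqP.
(* The exponential sums of the shifted initial values form a chain with the same initial values as
   [u]; the differences form a chain starting at 0. *)
pose v j t := u j t - exp_sum (a j) t.
apply: (@right_derivative_chain_zero R K S v (N + N * expR (b * M)) M b) => //.
- by rewrite addr_ge0// mulr_ge0// expR_ge0.
- move=> {t0 tb}j t1 e t0 e0; have e2 : 0 < e / 2 by rewrite divr_gt0.
  have [d1 d10 d1P] := cu j t1 _ t0 e2.
  have [d2 d20 d2P] := exp_sum_continuous M0 (aP j) t0 e2.
  exists (Num.min d1 d2); first by rewrite lt_min d10.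
  move=> s s0; rewrite lt_min => /andP[sd1 sd2]; rewrite /v opprD addrACA -opprD.
  rewrite (le_lt_trans (nrmD S _ _))// [e]splitr ltrD ?d1P// nrmN.
  exact: d2P.
- move=> {t0 tb}j t1 e t0 e0; have e2 : 0 < e / 2 by rewrite divr_gt0.
  have [d1 d10 d1P] := du j t1 _ t0 e2.
  have [d2 d20 d2P] := exp_sum_right_derivative M0 (aP j) t0 e2.
  exists (Num.min d1 d2); first by rewrite lt_min d10.
  move=> h h0; rewrite lt_min => /andP[hd1 hd2]; rewrite /v.
  have := d2P h h0 hd2; rewrite aS; have := d1P h h0 hd1.
  set p := u j _; set q := u j _; set r := u _ _; set p' := exp_sum _ _.
  set q' := exp_sum _ _; set r' := exp_sum _ _ => h1 h2.
  rewrite (_ : _ - _ = (p - q - S h * r) - (p' - q' - S h * r')); last by ring.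
  rewrite (le_trans (nrmD S _ _))// nrmN [e]splitr mulrDl.
  exact: lerD.
- by move=> j; rewrite /v (exp_sum0 (aP j)) /a add0n subrr.
move=> {t0 tb}j t1 t0 tb; rewrite /v (le_trans (nrmD S _ _))// nrmN mulrDl.
rewrite lerD ?uN// (le_trans (exp_sum_bound (aP j) t0))//.
rewrite mulrAC ler_wpM2r ?exprn_ge0// ler_wpM2l// ler_expR.
by rewrite ler_wpM2r.
Qed.

(** With [t] fixed, the sums of the shifted sequences at time [t + r] form a chain in [r], so
    [exp_sum_unique] recovers them from their values at [r = 0]. *)
Lemma exp_sum_add a N M s t : 0 <= M -> (forall k, nrm (a k) <= N * M ^+ k) ->
  0 <= s -> 0 <= t ->
  exp_sum a (t + s) = exp_sum (fun k => exp_sum (fun i => a (i + k)%N) t) s.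
Proof.
move=> M0 aP s0 t0; have aPj j := exp_dominated_shift j aP.
pose u j r := exp_sum (fun i => a (i + j)%N) (t + r).
have <- : u 0%N s = exp_sum a (t + s).
  by rewrite /u; congr (exp_sum _ _); apply/funext => i; rewrite addn0.
have uE : (fun k => u k 0) = (fun k => exp_sum (fun i => a (i + k)%N) t).
  by apply/funext => k; rewrite /u addr0.
have := @exp_sum_unique u (N * expR ((t + s) * M)) M s M0.
rewrite uE; apply; last 2 first; [exact: s0|exact: lexx| | |].
- move=> j r e r0 e0; have tr : 0 <= t + r by exact: addr_ge0.
  have [d d0 dP] := exp_sum_continuous M0 (aPj j) tr e0.
  exists d => // r' r'0 rr; apply: dP; first exact: addr_ge0.
  by rewrite opprD addrACA subrr add0r.
- move=> j r e r0 e0; have tr : 0 <= t + r by exact: addr_ge0.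
  have [d d0 dP] := exp_sum_right_derivative M0 (aPj j) tr e0.
  exists d => // h h0 hd; rewrite /u addrA.
  rewrite (_ : (fun i => a (i + j.+1)%N) = (fun i => a (i + j)%N) \o succn).
    exact: dP.
  by apply/funext => i; rewrite /= addSnnS.
- move=> j r r0 rs; rewrite /u.
  rewrite (le_trans (exp_sum_bound (aPj j) (addr_ge0 t0 r0)))//.
  rewrite mulrAC ler_wpM2r ?exprn_ge0// ler_wpM2l ?(exp_dominated_ge0 aP)//.
  by rewrite ler_expR ler_wpM2r// lerD2l.
Qed.

End ExpSumUniqueness.

(** * The exponential semigroup *)

Section ExponentialSemigroup.
Context (R : realType) (K : numFieldType) (S : real_scalars R K).
Context (X : topologicalType) (lcX : locally_compact [set: X]).
Local Notation nrm := (nrm S).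
Local Notation exp_sum := (exp_sum S).
Local Notation supnrm := (supnrm S).
Local Notation E := (cfun X K).
Context (w : E) (psi : continuousType X X) (st : stable_orbits psi).
Local Notation A := (weighted_comp w psi).
Implicit Types (C L : set X) (f g : E) (t s h e d N M b : R) (j k n : nat).

Lemma cfun_seriesE (u : nat -> E) n x :
  (series u n : E) x = series (fun k => u k x) n.
Proof. by rewrite /series /=; elim/big_ind2 : _ => // ? ? ? ? <- <-. Qed.

(** Uniformity on [C] holds because the tail estimate depends on [x] only through the common [N] and
    [M]. *)
Lemma exp_series_cvg (u : nat -> E) t C : 0 <= t ->
  (exists N M, forall k x, C x -> nrm (u k x) <= N * M ^+ k) ->
  forall e, 0 < e -> \forall n \near \oo, forall x, C x ->
    nrm (exp_sum (u^~ x) t - (series (fun k => S (exp_coeff t k) *: u k) n : E) x)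
      < e.
Proof.
move=> t0 [N [M uNM]] e e0.
have : (fun n => N * (expR (t * M) - series (exp_coeff (t * M)) n)) @ \oo -->
    N * (expR (t * M) - expR (t * M)).
  apply: cvgM; first exact: cvg_cst.
  by apply: cvgB; [exact: cvg_cst|exact: cvg_series_expR].
rewrite subrr mulr0 => /(@cvgrPdist_lt R R)/(_ e e0); apply: filterS => n.
rewrite sub0r normrN => ne x Cx; rewrite cfun_seriesE.
apply: le_lt_trans (exp_sum_tail (fun k => uNM k x Cx) n t0) _.
exact: le_lt_trans (ler_norm _) ne.
Qed.

(** A locally uniform limit of continuous partial sums: the usual three-term estimate on a compact
    neighbourhood of [x]. *)
Lemma exp_sum_cfun_continuous (u : nat -> E) t : 0 <= t ->
  (forall C, compact C ->
     exists N M, forall k x, C x -> nrm (u k x) <= N * M ^+ k) ->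
  continuous (fun x => exp_sum (u^~ x) t).
Proof.
move=> t0 uP x; apply/(cvg_nrmP S) => e e0.
have e3 : 0 < e / 3 by rewrite divr_gt0.
have [V cV /(_ x erefl) xV] := compact_neighborhood lcX (@compact_set1 _ x).
have [n _ /(_ n (leqnn n)) nP] := exp_series_cvg t0 (uP V cV) e3.
have Vx : V x := nbhs_singleton xV.
move: nP; set p : E := series _ n => nP.
have /(cvg_nrmP S)/(_ _ e3) := @cts_fun _ _ p x.
apply: filterS2 xV => y Vy pxy; set a := exp_sum _ t; set b := exp_sum _ t.
rewrite (_ : a - b = (a - p x) + (p x - p y) - (b - p y)); last by ring.
rewrite (le_lt_trans (nrmD S _ _))// nrmN.
rewrite (_ : e = e / 3 + e / 3 + e / 3); last by field.
rewrite ltrD ?nP// (le_lt_trans (nrmD S _ _))// ltrD// nP//.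
Qed.

Let iterA_dominated f C : compact C ->
  exists N M, forall k x, C x -> nrm (iter k A f x) <= N * M ^+ k.
Proof.
move=> cC; have [L cL [M M0 AM]] := stable_orbits_bound S w st cC.
by exists (supnrm L f), M => k x; exact: AM.
Qed.

Let exp_fun_continuous f z :
  continuous (fun x => exp_sum (fun k => iter k A f x) (nrm z)).
Proof.
apply: exp_sum_cfun_continuous; first exact: nrm_ge0.
exact: iterA_dominated.
Qed.

(* [nrm z] is z itself, read in R, when [0 <= z]; junk otherwise. *)
Definition exp_weighted_comp (z : K) f : E := mkcts (@exp_fun_continuous f z).
Local Notation T := exp_weighted_comp.

Lemma exp_weighted_compE z f x :
  T z f x = exp_sum (fun k => iter k A f x) (nrm z).
Proof. by []. Qed.

Lemma iter_weighted_comp_linear (c : K) f g k x :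
  iter k A (c *: f + g) x = c * iter k A f x + iter k A g x.
Proof.
by rewrite !iter_weighted_comp -[(c *: f + g) _]/(c * f _ + g _) mulrDr mulrCA.
Qed.

(** At a fixed [x], the iterate is a scalar times the evaluation at another point, so it passes
    through the series. *)
Lemma iter_weighted_comp_exp k z f x :
  iter k A (T z f) x = exp_sum (fun i => iter (i + k) A f x) (nrm z).
Proof.
rewrite iter_weighted_comp exp_weighted_compE.
set p := \prod_(i < k) _; set y := iter k psi x.
have [N [M NM]] := iterA_dominated f (@compact_set1 _ y).
rewrite -(exp_sumZ p (fun i => NM i y erefl) (nrm_ge0 S z)).
congr (exp_sum _ _); apply/funext => i.
by rewrite addnC iterD [RHS]iter_weighted_comp.
Qed.

(** Here [d] depends on [f] only through the bound [Q]. A single [f] gives strong continuity; a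
    bounded set of functions gives uniform continuity. *)
Lemma exp_weighted_comp_dist C : compact C -> exists2 L, compact L &
  forall Q t e, 0 <= t -> 0 < e -> exists2 d, 0 < d & forall s f, 0 <= s ->
    `|t - s| < d -> supnrm L f <= Q -> forall x, C x ->
    nrm (T (S t) f x - T (S s) f x) < e.
Proof.
move=> cC; have [L cL [M M0 AM]] := stable_orbits_bound S w st cC.
exists L => // Q t e t0 e0; have [d d0 dP] := expR_dist_small t M Q e0.
exists d => // s f s0 ts fQ x Cx; apply: le_lt_trans (dP s ts).
rewrite !exp_weighted_compE !nrm_ofR (ger0_norm s0) (ger0_norm t0).
apply: le_trans (exp_sum_dist_norm (ltW M0) (fun k => AM f k x Cx) s0 t0) _.
by rewrite ler_wpM2r.
Qed.

Lemma exp_weighted_comp_semigroup : strongly_continuous_semigroup T.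
Proof.
split.
- move=> z _; have lin : linear (T z).
    move=> c f g; apply: cfunP => x.
    have [N [M NM]] := iterA_dominated f (@compact_set1 _ x).
    have [N' [M' NM']] := iterA_dominated g (@compact_set1 _ x).
    rewrite -[RHS]/(c * T z f x + T z g x) !exp_weighted_compE.
    rewrite -(exp_sumD c (fun i => NM i x erefl) (fun i => NM' i x erefl) (nrm_ge0 S z)).
    congr (exp_sum _ _); apply/funext => i.
    exact: iter_weighted_comp_linear.
  split => // f P /(cfun_nbhs_nrmP S)[C cC [e e0 eP]].
  have [L cL [M M0 AM]] := stable_orbits_bound S w st cC.
  (* The factor [q] bounds [T z] from the supremum on [L] to the supremum on [C]. *)
  pose q := expR (nrm z * M); have q0 : 0 < q := expR_gt0 _.
  have eq0 : 0 < e / 2 / q by rewrite !divr_gt0.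
  apply/(cfun_nbhs_nrmP S); exists L => //; exists (e / 2 / q) => // g gf.
  apply: eP => x Cx.
  have -> : T z f x - T z g x = T z (f - g) x.
    have -> : T z (f - g) = -1 *: T z g + T z f.
      by rewrite -[RHS](lin (-1) g f) scaleN1r addrC.
    by rewrite -[RHS]/(-1 * T z g x + T z f x) mulN1r addrC.
  apply: le_lt_trans (exp_sum_bound (fun k => AM (f - g) k x Cx) (nrm_ge0 S z)) _.
  rewrite -/q; apply: (@le_lt_trans _ _ (e / 2)).
    rewrite -ler_pdivlMr// supnrm_le ?(ltW eq0)// => y Ly.
    by apply/ltW; exact: gf.
  by rewrite ltr_pdivrMr// ltr_pMr// ltr1n.
- apply/funext => f; apply: cfunP => x.
  have [N [M NM]] := iterA_dominated f (@compact_set1 _ x).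
  by rewrite exp_weighted_compE nrm0 (exp_sum0 (fun i => NM i x erefl)).
- move=> y z y0 z0; apply/funext => f; apply: cfunP => x /=.
  rewrite !exp_weighted_compE.
  have [L cL [M M0 AM]] := stable_orbits_bound S w st (@compact_set1 _ x).
  (* The inner exponential comes from [T z], so its time stands first, as in [exp_sum_add]. *)
  have -> : nrm (y + z) = nrm z + nrm y.
    by apply: (fmorph_inj S); rewrite rmorphD !ofR_nrm_ge0 ?addr_ge0// addrC.
  rewrite (exp_sum_add (ltW M0) (fun k => AM f k x erefl) (nrm_ge0 S y) (nrm_ge0 S z)).
  by congr (exp_sum _ _); apply/funext => k; rewrite iter_weighted_comp_exp.
move=> f; apply/subspace_continuousP => z z0; apply/(cfun_cvgP S) => C e cC e0.
have [r zr] := ofR_onto S z0; have r0 : 0 <= r by rewrite -(ofR_le S) rmorph0 -zr.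
have [L cL LP] := exp_weighted_comp_dist cC.
have [d d0 dP] := LP (supnrm L f) r e r0 e0.
rewrite near_withinE; apply/nbhs_ballP; exists (S d); first exact: ofR_gt0.
move=> y; rewrite -ball_normE /= => zy y0 x Cx.
have [s ys] := ofR_onto S y0; rewrite zr ys; apply: dP => //.
  by rewrite -(ofR_le S) rmorph0 -ys.
by move: zy; rewrite zr ys -rmorphB (nrm_lt S) nrm_ofR.
Qed.

Lemma exp_weighted_comp_uniform : uniformly_continuous_semigroup T.
Proof.
split; first exact: exp_weighted_comp_semigroup.
apply/subspace_continuousP => z z0.
have [r zr] := ofR_onto S z0; have r0 : 0 <= r by rewrite -(ofR_le S) rmorph0 -zr.
apply/fam_cvgP => B bB P /uniform_nbhs[V [[U [U0 UV]] VP]].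
have [C cC [e e0 CU]] := proj1 (cfun_nbhs_nrmP S 0 U) U0.
have [L cL LP] := exp_weighted_comp_dist cC.
(* Since [B] is absorbed by this neighbourhood of 0, its elements have a common bound [q] on [L]. *)
have L1 : nbhs (0 : E) [set g : E | forall x, L x -> nrm ((0 : E) x - g x) < 1].
  by apply/(cfun_nbhs_nrmP S); exists L => //; exists 1.
have [_ /(pos_ofR S)[q q0 ->] BQ] := bB _ L1.
have [d d0 dP] := LP q r e r0 e0.
have : \forall y \near within [set t : K | 0 <= t] (nbhs z), P (T y).
  rewrite near_withinE; apply/nbhs_ballP; exists (S d); first exact: ofR_gt0.
  move=> y; rewrite -ball_normE /= => zy y0; apply: VP => f Bf.
  have [s ys] := ofR_onto S y0.
  apply/set_mem/UV/mem_set/CU => x Cx /=.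
  rewrite -[X in nrm X]/(0 - (T z f x - T y f x)) sub0r nrmN zr ys.
  apply: dP => //.
  - by rewrite -(ofR_le S) rmorph0 -ys.
  - by move: zy; rewrite zr ys -rmorphB (nrm_lt S) nrm_ofR.
  apply: supnrm_le; first exact: ltW.
  have [g gL <-] := BQ _ Bf => u Lu.
  rewrite -[X in nrm X]/(S q * g u) nrmM nrm_ofR gtr0_norm//.
  rewrite ger_pMr// ltW//; have := gL u Lu.
  by rewrite -[X in nrm X]/(0 - g u) sub0r nrmN.
by [].
Qed.

(** The first-order remainder at time 0 is at most [e / 2 * h], uniformly on [C]; dividing by [h]
    gives the limit for every [f]. *)
Lemma exp_weighted_comp_generator : is_generator T setT A.
Proof.
have lim f : generator_limit T f (A f).
  apply/(cfun_cvgP S) => C e cC e0.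
  have [L cL [M M0 AM]] := stable_orbits_bound S w st cC.
  have e2 : 0 < e / 2 by rewrite divr_gt0.
  have [d d0 dP] := expR_tangent_small 0 (ltW M0) (supnrm_ge0 S f cL) e2.
  rewrite near_withinE; apply/nbhs_ballP; exists (S d); first exact: ofR_gt0.
  move=> z; rewrite -ball_normE /= sub0r normrN (nrm_lt S) => zd z0 x Cx.
  have [h zh] := ofR_onto S (ltW z0).
  have h0 : 0 < h by rewrite -(ofR_lt S) rmorph0 -zh.
  have nh : nrm z = h by rewrite zh nrm_ofR gtr0_norm.
  rewrite nh in zd.
  have aP k : nrm (iter k A f x) <= supnrm L f * M ^+ k by exact: AM.
  have aP1 k : nrm (((fun k => iter k A f x) \o succn) k) <=
      supnrm L f * M * M ^+ k by rewrite -mulrA -exprS; exact: AM.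
  have := le_trans (exp_sum_tangent aP (lexx 0) (ltW h0)) (dP h h0 zd).
  rewrite add0r (exp_sum0 aP) (exp_sum0 aP1) -[(_ \o _) _]/(A f x).
  rewrite -[X in exp_sum _ X]nh -exp_weighted_compE -zh => hle.
  rewrite -[X in nrm X]/(A f x - z^-1 * (T z f x - f x)).
  have zn0 : z != 0 by rewrite gt_eqF.
  have -> : A f x - z^-1 * (T z f x - f x) =
      - (z^-1 * (T z f x - f x - z * A f x)).
    by rewrite [z^-1 * (_ - z * _)]mulrBr [z^-1 * (z * _)]mulrA mulVf// mul1r opprB.
  rewrite nrmN nrmM nrmV nh mulrC ltr_pdivrMr//.
  apply: le_lt_trans hle _; rewrite ltr_pM2r//.
  by rewrite ltr_pdivrMr// ltr_pMr// ltr1n.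
split => [|f _]; last exact: lim.
by apply/seteqP; split => // f _; exists (A f); exact: lim.
Qed.

End ExponentialSemigroup.

(** * Exponential series of a given semigroup *)

Section SemigroupSeries.
Context (R : realType) (K : numFieldType) (S : real_scalars R K).
Context (X : topologicalType).
Local Notation nrm := (nrm S).
Local Notation exp_sum := (exp_sum S).
Local Notation supnrm := (supnrm S).
Local Notation E := (cfun X K).
Context (w : E) (psi : continuousType X X) (st : stable_orbits psi).
Local Notation A := (weighted_comp w psi).
Context (T : K -> E -> E) (scT : strongly_continuous_semigroup T).
Context (genT : is_generator T setT A).
Local Notation U t := (T (S t)).
Implicit Types (C L : set X) (f g : E) (t s h e d N M b : R) (j k n : nat).

(** Continuity bounds the orbit near each time, and [real_induction] joins these local bounds along
    the interval. *)
Lemma semigroup_orbit_bounded f L b : compact L -> exists N,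
  forall t, 0 <= t -> t <= b -> supnrm L (U t f) <= N.
Proof.
move=> cL; pose P t := exists N, forall s, 0 <= s -> s <= t -> supnrm L (U s f) <= N.
have near_bound t : 0 <= t -> exists2 d, 0 < d & forall s, 0 <= s ->
    `|t - s| < d -> supnrm L (U s f) <= supnrm L (U t f) + 1.
  move=> t0; have [d d0 dP] := semigroup_cvg S scT f t0 cL ltr01.
  exists d => // s s0 ts; rewrite -[U s f](subrK (U t f)) addrC.
  rewrite (le_trans (supnrmD S _ _ cL))// lerD2l supnrm_le// => x Lx.
  by rewrite -[X in nrm X]/(U s f x - U t f x) nrm_dist ltW// dP.
have Pmax t s d N : supnrm L (U t f) <= N ->
    (forall r, 0 <= r -> r <= s -> supnrm L (U r f) <= N) ->
    (forall r, 0 <= r -> `|t - r| < d -> supnrm L (U r f) <= supnrm L (U t f) + 1) ->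
    forall r, 0 <= r -> r <= s \/ `|t - r| < d -> supnrm L (U r f) <= N + 1.
  move=> tN sN dN r r0 [rs|rt].
    by rewrite (le_trans (sN r r0 rs))// lerDl.
  by rewrite (le_trans (dN r r0 rt))// lerD2r.
suff Pt : forall t, 0 <= t -> t <= b -> P t.
  have [b0|b0] := leP 0 b; first by have [N NP] := Pt b b0 (lexx b); exists N.
  by exists 0 => t t0 tb; move: b0; rewrite ltNge (le_trans t0 tb).
apply: real_induction.
- exists (supnrm L (U 0 f)) => s s0 s1.
  by rewrite (_ : s = 0)//; apply/eqP; rewrite eq_le s0 s1.
- move=> t t0 tb /(_ t t0 (lexx t))[N NP].
  have [d d0 dP] := near_bound t t0; exists d => // h h0 hd.
  exists (N + 1) => s s0 sh.
  apply: (Pmax t t d) => //; first exact: NP.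
  have [st'|ts] := leP s t; [by left|right].
  rewrite distrC ger0_norm ?subr_ge0 ?(ltW ts)//.
  by rewrite ltrBlDl (le_lt_trans sh)// ltrD2l.
- move=> t t0 tb IH; have [d d0 dP] := near_bound t (ltW t0).
  pose h := Num.min (d / 2) t.
  have h0 : 0 < h by rewrite lt_min divr_gt0.
  have th0 : 0 <= t - h by rewrite subr_ge0 ge_min lexx orbT.
  have [N NP] : P (t - h) by apply: IH => //; rewrite gtrBl.
  exists (Num.max N (supnrm L (U t f)) + 1) => s s0 sh.
  apply: (Pmax t (t - h) d) => //; first by rewrite le_max lexx orbT.
    by move=> r r0 rt; rewrite le_max NP.
  have [st'|ts] := leP s (t - h); [by left|right].
  rewrite ger0_norm ?subr_ge0// ltrBlDl -ltrBlDr (le_lt_trans _ ts)//.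
  rewrite lerD2l lerN2 ge_min ler_pdivrMr// ler_pMr// ler1n//.
Qed.

(** The functions [U r (iter j A f) x] of [r] form a chain of right derivatives. Moving [iter j A]
    outside [U r] makes their growth in [j] geometric, by stable orbits and boundedness of the orbit
    of [f], so [exp_sum_unique] applies. *)
Lemma semigroup_exp_sum f t x : 0 <= t ->
  U t f x = exp_sum (fun k => iter k A f x) t.
Proof.
move=> t0; have [L cL [M M0 AM]] := stable_orbits_bound S w st (@compact_set1 _ x).
have [N NP] := semigroup_orbit_bounded f t cL.
have commute j r : 0 <= r -> U r (iter j A f) = iter j A (U r f).
  move=> r0; elim: j => // j IH.
  by rewrite !iterS -IH (semigroup_generator_commute S scT genT).
pose u j r := U r (iter j A f) x.
rewrite (_ : (fun k => _) = (fun k => u k 0)); last first.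
  by apply/funext => k; rewrite /u (semigroup0 S scT).
apply: (@exp_sum_unique R K S u N M t (ltW M0)) => //.
- move=> j r e r0 e0.
  have [d d0 dP] := semigroup_cvg S scT (iter j A f) r0 (@compact_set1 _ x) e0.
  by exists d => // s s0 rs; exact: dP.
- move=> j r e r0 e0.
  exact: (semigroup_right_derivative S scT genT (iter j A f) x r0 e0).
move=> j r r0 rt; rewrite /u commute// (le_trans (AM (U r f) j x erefl))//.
by rewrite ler_wpM2r ?NP// exprn_ge0// ltW.
Qed.

Lemma semigroup_series_cvg (z : K) f : 0 <= z ->
  series (fun k => (z ^+ k / k`!%:R) *: iter k A f) @ \oo --> T z f.
Proof.
move=> z0; have [t zt] := ofR_onto S z0.
have t0 : 0 <= t by rewrite -(ofR_le S) rmorph0 -zt.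
rewrite (_ : (fun k => _) = (fun k => S (exp_coeff t k) *: iter k A f)); last first.
  by apply/funext => k; rewrite /exp_coeff /= fmorph_div rmorphXn rmorph_nat zt.
apply/(cfun_cvgP S) => C e cC e0.
have [L cL [M M0 AM]] := stable_orbits_bound S w st cC.
have := @exp_series_cvg R K S X (fun k => iter k A f) t C t0.
move=> /(_ (ex_intro _ (supnrm L f) (ex_intro _ M (fun k x => AM f k x))) e e0).
by apply: filterS => n nP x Cx; rewrite zt semigroup_exp_sum//; exact: nP.
Qed.

End SemigroupSeries.

Unset Implicit Arguments.

Theorem theorem5p1 (R : realType) (K : numFieldType)
    (RorC : K = (R : numFieldType) \/ K = (R[i]%C : numFieldType))
    (X : topologicalType)
    (X_locally_compact : locally_compact [set: X])
    (X_sigma_compact : sigma_compact X)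
    (X_noncompact : ~ compact [set: X])
    (X_hausdorff : hausdorff_space X)
    (w : cfun X K) (psi : continuousType X X)
    (w_dense : dense (w @^-1` [set a : K | a != 0]))
    (psi_local : locally_injective_open psi) :
  [<-> exists T : K -> cfun X K -> cfun X K, uniformly_continuous_semigroup T /\
         is_generator T setT (weighted_comp w psi);
       exists T : K -> cfun X K -> cfun X K, strongly_continuous_semigroup T /\
         is_generator T setT (weighted_comp w psi);
       m_topologizable (weighted_comp w psi);
       topologizable (weighted_comp w psi);
       stable_orbits psi] /\
  (forall T : K -> cfun X K -> cfun X K, strongly_continuous_semigroup T ->
     is_generator T setT (weighted_comp w psi) ->
   forall (t : K) (f : cfun X K), 0 <= t ->
     series (fun k : nat => (t ^+ k / k`!%:R) *: iter k (weighted_comp w psi) f)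
       @ \oo --> T t f).
Proof.
have [S] : inhabited (real_scalars R K).
  by case: RorC => ->; constructor;
    [exact: real_scalars_real|exact: real_scalars_complex].
have stable := stable_orbits_of_local S X_locally_compact X_hausdorff
  w_dense psi_local.
have gen_stable T : strongly_continuous_semigroup T ->
    is_generator T setT (weighted_comp w psi) -> stable_orbits psi.
  by move=> scT genT; apply/stable/(semigroup_local_iterates S scT genT).
split=> [|T scT genT t f t0]; last first.
  exact: (semigroup_series_cvg S (gen_stable T scT genT) scT genT).
tfae.
- by move=> [T [[scT _] genT]]; exists T.
(* This implication passes through stable orbits, obtained from the gliding hump. *)
- by move=> [T [scT genT]]; apply: (m_topologizable_of_stable S); exact: gen_stable genT.
- move=> mtop p /mtop[q cq [c c0 cP]]; exists q => // m.
  by exists (c ^+ m); [exact: exprn_gt0|exact: cP].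
- by move=> /(topologizable_local S)/stable.
- move=> st; exists (exp_weighted_comp S X_locally_compact w st); split.
    exact: exp_weighted_comp_uniform.
  exact: exp_weighted_comp_generator.
Qed.
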